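(* Let $E$ be a (not necessarily unital) operator system. Suppose that there is a collection of C*-algebras $(\mathcal{M}_i)_i$ and positive linear maps $\rho_i : \mathcal{M}_i \to E$ such that $E = \overline{\bigcup_i \rho_i(\mathcal{M}_i)}$ (norm closure). The following are equivalent: (1) $E$ is isomorphic to a C*-algebra. (2) The canonical unitization $E^\sharp$ is isomorphic to a C*-algebra.
   Context: An operator system is a norm-closed subspace $E \subseteq B(H)$ ($H$ a Hilbert space) closed under the adjoint; it need not contain the unit of $B(H)$. $M_d(E)\subseteq M_d(B(H))=B(H^d)$ carries the inherited norm and positive cone $M_d(E)_+ = M_d(E)\cap B(H^d)_+$; $E_+=M_1(E)_+$. A linear map is positive if it maps positive elements to positive elements. Isomorphisms are isomorphisms of operator systems: linear bijections that are completely isometric and such that the map and its inverse are completely positive. Canonical unitization: $E^\sharp = E\oplus\mathbb{C}$ as a $*$-vector space, with unit $(0,1)$. Identifying $M_d(E^\sharp)=M_d(E)\oplus M_d$, a self-adjoint element $(X,A)$ is positive iff $A\ge 0$ and $\varphi\big((A+\varepsilon 1)^{-1/2}X(A+\varepsilon 1)^{-1/2}\big)\ge -1$ for every $\varepsilon>0$ and every quasistate $\varphi$ on $M_d(E)$ (a positive linear functional on $M_d(E)$ of norm at most $1$). With these cones and the associated order-unit matrix norms $E^\sharp$ is a unital operator system containing $E$ completely isometrically. (A new unit is adjoined even if $E$ is already unital.) *)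

(* Defs.v *)
From HB Require Import structures.
From mathcomp Require Import all_boot all_order all_algebra.
From mathcomp Require Import sesquilinear complex.
From mathcomp Require Import all_classical all_reals all_analysis.
Set Implicit Arguments.
Unset Strict Implicit.
Unset Printing Implicit Defensive.
Import Order.TTheory GRing.Theory Num.Theory.
Import numFieldNormedType.Exports.
Local Open Scope classical_set_scope.
Local Open Scope ring_scope.
Local Open Scope complex_scope.

(* Complex Hilbert spaces; the inner product is linear in its first argument.
   The order of [R[i]] is the one of [numDomainType]: [0 <= z] says that [z]
   is real and nonnegative. *)
Record hilbertSpace (R : realType) := HilbertSpace {
  hs_sort :> completeNormedModType R[i];
  dotp : {dot hs_sort for (@Num.conj R[i])};
  dotpE : forall x : hs_sort, `|x| ^+ 2 = dotp x x }.

Section BoundedOperators.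
Variables (R : realType) (H : hilbertSpace R).

Definition bounded_operator : {pred (H -> H)} := fun f =>
  `[< linear f /\ exists c : R[i], forall x, `|f x| <= c * `|x| >].

Lemma bounded_operator_submod : submod_closed bounded_operator.
Proof.
split.
  have fun0 (x : H) : (0 : H -> H) x = 0 by [].
  apply/asboolP; split; first by move=> a x y; rewrite !fun0 scaler0 addr0.
  by exists 0 => x; rewrite fun0 normr0 mul0r.
move=> a f g /asboolP[linf [c fc]] /asboolP[ling [c' gc]]; apply/asboolP; split.
  move=> b x y; rewrite !fctE linf ling !scalerDr !scalerA (mulrC b a).
  by rewrite -!addrA; congr (_ + _); rewrite addrCA.
exists (`|a| * c + c') => x; rewrite !fctE (le_trans (ler_normD _ _))//.
by rewrite mulrDl lerD// normrZ -mulrA ler_wpM2l.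
Qed.

HB.instance Definition _ :=
  GRing.isSubmodClosed.Build R[i] (H -> H) bounded_operator
    bounded_operator_submod.

(* B(H) *)
Record bop := Bop { bop_fun :> H -> H; bopP : bop_fun \in bounded_operator }.
HB.instance Definition _ := [isSub for bop_fun].
HB.instance Definition _ := [Choice of bop by <:].
HB.instance Definition _ := [SubChoice_isSubLmodule of bop by <:].

Lemma bop_comp_subproof (S T : bop) : S \o T \in bounded_operator.
Proof.
case: S T => S /asboolP[linS [c Sc]] [T /asboolP[linT [c' Tc]]] /=.
apply/asboolP; split; first by move=> a x y /=; rewrite linT linS.
have [c0|/negbTE c0] := boolP (0 <= c).
  exists (c * c') => x /=; rewrite (le_trans (Sc _))//.
  by rewrite -mulrA ler_wpM2l.
exists 0 => x /=; rewrite mul0r.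
have /eqP : `|T x| = 0.
  apply/eqP/negPn/negP => Tx0.
  have Tx_gt0 : 0 < `|T x| by rewrite lt_def Tx0 normr_ge0.
  have := le_trans (normr_ge0 _) (Sc (T x)).
  by rewrite pmulr_lge0// c0.
by move/eqP => Tx0; have := Sc (T x); rewrite Tx0 mulr0.
Qed.

Definition bop_comp (S T : bop) : bop := Bop (bop_comp_subproof S T).

Definition is_adjoint (T S : bop) :=
  forall x y : H, dotp H (T x) y = dotp H x (S y).

(* The adjoint exists and is unique by the Riesz representation theorem, so the
   default value 0 is never taken. *)
Definition adj (T : bop) : bop := xget 0 [set S | is_adjoint T S].

(* Vectors of H^d are functions 'I_d -> H, and 'M[bop]_d acts on them through
   the identification M_d(B(H)) = B(H^d). *)
Definition mx_act d (X : 'M[bop]_d) (xi : 'I_d -> H) : 'I_d -> H :=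
  fun i => \sum_(j < d) X i j (xi j).

Definition vnorm d (xi : 'I_d -> H) : R :=
  Num.sqrt (\sum_(i < d) (complex.Re `|xi i|) ^+ 2).

Definition op_mxnorm d (X : 'M[bop]_d) : R :=
  sup [set vnorm (mx_act X xi) | xi in [set xi | vnorm xi <= 1]].

Definition op_mxpos d : set 'M[bop]_d := [set X |
  forall xi : 'I_d -> H, 0 <= \sum_(i < d) dotp H (mx_act X xi i) (xi i)].

Definition opnorm (T : bop) : R := op_mxnorm (const_mx T : 'M[bop]_1).

Definition norm_closure (A : set bop) : set bop :=
  [set T | forall eps : R, 0 < eps -> exists2 S, A S & opnorm (T - S) < eps].

End BoundedOperators.

(* What isomorphisms of operator systems refer to: a complex vector space V with
   a positive cone and a norm on each M_d(V). *)
Record matrixSystem (R : realType) := MatrixSystem {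
  ms_sort :> lmodType R[i];
  ms_pos : forall d, set 'M[ms_sort]_d;
  ms_norm : forall d, 'M[ms_sort]_d -> R }.

Section Morphisms.
Variables (R : realType) (V W : matrixSystem R).

Definition positive_map (f : {linear V -> W}) := forall x : V,
  ms_pos (const_mx x : 'M[V]_1) -> ms_pos (const_mx (f x) : 'M[W]_1).

Definition completely_positive (f : {linear V -> W}) :=
  forall d (X : 'M[V]_d), ms_pos X -> ms_pos (map_mx f X).

Definition completely_isometric (f : {linear V -> W}) :=
  forall d (X : 'M[V]_d), ms_norm (map_mx f X) = ms_norm X.

End Morphisms.

Definition isomorphic (R : realType) (V W : matrixSystem R) :=
  exists (f : {linear V -> W}) (g : {linear W -> V}),
  [/\ cancel f g, cancel g f, completely_isometric f,
      completely_positive f & completely_positive g].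

Record operatorSystem (R : realType) (H : hilbertSpace R) := OperatorSystem {
  os_pred : {pred bop H};
  os_submod : submod_closed os_pred;
  os_adj : {in os_pred, forall T, adj T \in os_pred};
  os_closed : norm_closure [set` os_pred] `<=` [set` os_pred] }.

Section OperatorSystem.
Variables (R : realType) (H : hilbertSpace R) (E : operatorSystem H).

HB.instance Definition _ :=
  GRing.isSubmodClosed.Build R[i] (bop H) (os_pred E) (os_submod E).

Record os_elt := OsElt { os_val :> bop H; os_valP : os_val \in os_pred E }.
HB.instance Definition _ := [isSub for os_val].
HB.instance Definition _ := [Choice of os_elt by <:].
HB.instance Definition _ := [SubChoice_isSubLmodule of os_elt by <:].

Definition os_star (x : os_elt) : os_elt := OsElt (os_adj (os_valP x)).

Definition os_system : matrixSystem R := @MatrixSystem R os_elt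
  (fun d => [set X | op_mxpos (map_mx os_val X)])
  (fun d X => op_mxnorm (map_mx os_val X)).

End OperatorSystem.

Coercion os_system : operatorSystem >-> matrixSystem.

(* Norm-closed *-subalgebras of B(H), not necessarily unital. *)
Record cstarAlgebra (R : realType) (H : hilbertSpace R) := CstarAlgebra {
  cs_system :> operatorSystem H;
  cs_comp : {in os_pred cs_system &,
    forall S T, bop_comp S T \in os_pred cs_system} }.

Definition isomorphic_to_cstar (R : realType) (V : matrixSystem R) :=
  exists (K : hilbertSpace R) (A : cstarAlgebra K), isomorphic V A.

Section ScalarMatrices.
Variable R : realType.

Definition psdmx d (A : 'M[R[i]]_d) := forall v : 'cV[R[i]]_d,
  0 <= ((map_mx Num.conj v)^T *m A *m v) 0 0.

(* A ^ (-1/2), for A positive definite. *)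
Definition invsqrtmx d (A : 'M[R[i]]_d) : 'M[R[i]]_d :=
  xget 0 [set B | psdmx B /\ B *m B = invmx A].

(* The product B X B in the M_d-bimodule M_d(V). *)
Definition mx_sandwich (V : lmodType R[i]) d (B : 'M[R[i]]_d) (X : 'M[V]_d) :
    'M[V]_d :=
  \matrix_(i, j) \sum_(k < d) \sum_(l < d) (B i k * B l j) *: X k l.

End ScalarMatrices.

Section Unitization.
Variables (R : realType) (H : hilbertSpace R) (E : operatorSystem H).

Definition quasistate d (phi : 'M[E]_d -> R[i]) :=
  [/\ forall (a : R[i]) (X Y : 'M[E]_d),
        phi (map_mx ( *:%R a) X + Y) = a * phi X + phi Y,
      forall X : 'M[E]_d, ms_pos X -> 0 <= phi X &
      forall X : 'M[E]_d, `|phi X| <= (ms_norm X)%:C].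

Definition sharp_sort : lmodType R[i] := (E * R[i]^o)%type.

Definition sharp_star (z : sharp_sort) : sharp_sort :=
  (os_star z.1, Num.conj (z.2 : R[i])).

Definition sharp_mxstar d (Z : 'M[sharp_sort]_d) : 'M[sharp_sort]_d :=
  (map_mx sharp_star Z)^T.

(* [phi] need not be hermitian when the cone of M_d(E) does not span, and then
   its values at self-adjoint elements need not be real. Taking the real part
   amounts to ranging over the hermitian quasistates (phi + phi^* )/2. *)
Definition sharp_pos d : set 'M[sharp_sort]_d := [set Z |
  let X : 'M[E]_d := map_mx fst Z in
  let A : 'M[R[i]]_d := map_mx snd Z in
  [/\ sharp_mxstar Z = Z, psdmx A &
    forall (eps : R) (phi : 'M[E]_d -> R[i]), 0 < eps -> quasistate phi ->
      -1 <= complex.Re (phi (mx_sandwich (invsqrtmx (A + (eps%:C)%:M)) X))]].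

(* t times the unit (0, 1) of M_d(E) + M_d *)
Definition sharp_scalar d (t : R) : 'M[sharp_sort]_d :=
  \matrix_(i, j) (0, (t%:C)%:M i j).

(* The order-unit matrix norm: Z has norm at most t iff the matrix
   [[t 1, Z], [Z^*, t 1]] is positive. *)
Definition sharp_norm d (Z : 'M[sharp_sort]_d) : R :=
  inf [set t : R | 0 < t /\
    sharp_pos (block_mx (sharp_scalar d t) Z
                        (sharp_mxstar Z) (sharp_scalar d t))].

Definition sharp : matrixSystem R :=
  @MatrixSystem R sharp_sort sharp_pos sharp_norm.

End Unitization.

(* Main.v *)
Require Import Defs.
From HB Require Import structures.
From mathcomp Require Import all_boot all_order all_algebra.
From mathcomp Require Import sesquilinear complex spectral.
From mathcomp Require Import all_classical all_reals all_analysis.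
From mathcomp Require Import ring lra.
Set Implicit Arguments.
Unset Strict Implicit.
Unset Printing Implicit Defensive.
Import Order.TTheory GRing.Theory Num.Theory.
Import numFieldNormedType.Exports.
Local Open Scope classical_set_scope.
Local Open Scope ring_scope.
Local Open Scope complex_scope.

(* If E is isomorphic to a C*-algebra A in B(K), then E^# is isomorphic to
   A^#, which is represented on the direct sum of K and C by letting (x, l) act
   as (x + l) (+) l. That the cones agree amounts to Re phi(Y) >= -1 for every
   quasistate phi and every self-adjoint Y >= -1 in M_d(A).

   Conversely, let E^# be isomorphic to a C*-algebra B, and let chi be the
   positive functional (x, l) |-> l transported to B. For p >= 0 in E,
   chi(p) = 0, hence chi(p^2) <= ‖p‖ chi(p) = 0 and, by Cauchy-Schwarz,
   chi(S p) = 0 for all S in B. Each rho_i maps a C*-algebra, which is spanned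
   by its positive elements, into the span of the positive elements of E; so
   this span is dense in E and chi vanishes on B E. The kernel of chi, which is
   the image of E, is therefore a C*-subalgebra of B. *)

(** The obstacle in the first direction is that [A] may have no unit: Y + 1 then lies outside
    M_d(A), and a quasistate cannot be evaluated on it. It is replaced by e (Y + 1) e = e Y e + e^2
    for a contraction e in M_d(A) with e Y e close to Y. No functional calculus is used for
    operators: e is a polynomial in Y without constant term, and a self-adjoint element is split by
    norm-convergent series of squares. The inequalities that remain concern real quadratic forms,
    hence the real-valued inner products.

    Isomorphisms are assumed linear, completely positive and completely isometric. That they commute
    with adjoints, and that chi is hermitian, is derived from the spanning of a C*-algebra by its
    positive elements; the bound on chi comes from the order-unit norm. The maps rho_i provide
    enough positive elements of E: its cone could otherwise be {0}, and positivity of chi would say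
    nothing about chi on B E. *)

Section ComplexParts.
Variable R : realType.
Implicit Types x y : R[i].

Lemma cReD x y : complex.Re (x + y) = complex.Re x + complex.Re y.
Proof. by case: x y => [a b] [c d]. Qed.

Lemma cReN x : complex.Re (- x) = - complex.Re x.
Proof. by case: x. Qed.

Lemma cRe_realM (t : R) x : complex.Re (t%:C * x) = t * complex.Re x.
Proof. by case: x => a b /=; rewrite mul0r subr0. Qed.

Lemma cRe_conj x : complex.Re (Num.conj x) = complex.Re x.
Proof. by case: x. Qed.

Lemma cRe_ge0 x : 0 <= x -> 0 <= complex.Re x.
Proof. by rewrite lecE => /andP[]. Qed.

Lemma conj_real (t : R) : Num.conj (t%:C) = t%:C :> R[i].
Proof. by rewrite /Num.conj/= oppr0. Qed.

End ComplexParts.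

(** The degenerate case [q = 0] is covered because the forms in [inner] are only semidefinite.
    Besides Cauchy-Schwarz, this gives the estimate for near-minimisers in [riesz]. *)
Lemma quad_discriminant (R : realType) (q p r : R) : 0 <= q -> 0 <= r ->
  (forall t, 0 <= q * t ^+ 2 + 2 * p * t + r) -> p ^+ 2 <= q * r.
Proof.
move=> q0 r0 h; have [q_gt0|] := ltP 0 q; last first.
  move=> q_le0; have q00 : q = 0 by lra.
  have p0 : p = 0.
    (* At this point the affine function 2 p t + r takes the value -1. *)
    apply/eqP/negP => /negP p0; have := h (- (r + 1) / (2 * p)).
    rewrite q00 mul0r add0r (_ : 2 * p * _ = - (r + 1)); first by lra.
    by field; rewrite p0.
  by rewrite p0 expr0n/= mulr_ge0.
have := h (- (p / q)).
rewrite (_ : _ + r = (r * q - p ^+ 2) / q); last by field; lra.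
by rewrite pmulr_lge0 ?invr_gt0// subr_ge0 mulrC.
Qed.

(** * Real inner products and positive operators *)

(** Semidefinite only, so that [form_inner] makes an instance of every positive operator and
    Cauchy-Schwarz applies to it. Real values lose no information, by [dotp_rdot]. *)
Record inner (R : realType) (V : lmodType R[i]) := Inner {
  ip :> V -> V -> R;
  ipC : forall x y, ip x y = ip y x;
  ipDl : forall x y z, ip (x + y) z = ip x z + ip y z;
  ipZl : forall (t : R) x y, ip (t%:C *: x) y = t * ip x y;
  ip_ge0 : forall x, 0 <= ip x x }.

Record is_oper (R : realType) (V : lmodType R[i]) (T : V -> V) : Prop := IsOper {
  operD : forall x y, T (x + y) = T x + T y;
  operZ : forall (t : R) x, T (t%:C *: x) = t%:C *: T x }.

Section Inner.
Variables (R : realType) (V : lmodType R[i]) (b : inner V).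
Implicit Types (x y z : V) (T S : V -> V) (c : R).

Lemma ipDr x y z : b x (y + z) = b x y + b x z.
Proof. by rewrite ipC ipDl !(ipC _ _ x). Qed.

Lemma ipZr (t : R) x y : b x (t%:C *: y) = t * b x y.
Proof. by rewrite ipC ipZl ipC. Qed.

Lemma oppr_scale x : - x = (-1)%:C *: x.
Proof. by rewrite rmorphN rmorph1 scaleN1r. Qed.

Lemma ipNl x y : b (- x) y = - b x y.
Proof. by rewrite oppr_scale ipZl mulN1r. Qed.

Lemma ipNr x y : b x (- y) = - b x y.
Proof. by rewrite ipC ipNl ipC. Qed.

Lemma ipBl x y z : b (x - y) z = b x z - b y z.
Proof. by rewrite ipDl ipNl. Qed.

Lemma ipBr x y z : b x (y - z) = b x y - b x z.
Proof. by rewrite ipDr ipNr. Qed.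

Definition ipE := (ipDl, ipDr, ipBl, ipBr, ipNl, ipNr, ipZl, ipZr).

Lemma ip0l x : b 0 x = 0.
Proof. by rewrite -[0](subrr x) ipBl subrr. Qed.

Lemma ip_CS x y : b x y ^+ 2 <= b x x * b y y.
Proof.
rewrite mulrC; apply: quad_discriminant; rewrite ?ip_ge0// => t.
have := ip_ge0 b (x + t%:C *: y); rewrite !ipE (ipC b y x); nra.
Qed.

Lemma operB T x y : is_oper T -> T (x - y) = T x - T y.
Proof.
by move=> hT; rewrite !oppr_scale (operD hT) (operZ hT).
Qed.

Definition symop T := forall x y, b (T x) y = b x (T y).
Definition posop T := forall x, 0 <= b (T x) x.
(* ‖T x‖ <= c ‖x‖, with squares on both sides *)
Definition bddop T c := forall x, b (T x) (T x) <= c ^+ 2 * b x x.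

Definition form_inner T (hT : is_oper T) (sT : symop T) (pT : posop T) : inner V :=
  @Inner R V (fun x y => b (T x) y)
    (fun x y => etrans (sT x y) (ipC b x (T y)))
    (fun x y z => etrans (congr1 (b ^~ z) (operD hT x y)) (ipDl b _ _ _))
    (fun t x y => etrans (congr1 (b ^~ y) (operZ hT t x)) (ipZl b _ _ _))
    pT.

End Inner.

Section PositiveOperators.
Variables (R : realType) (V : lmodType R[i]) (b : inner V).
Implicit Types (x y z : V) (T S : V -> V) (c : R).

(** Cauchy-Schwarz for the form of [T] at [x] and [T x] gives ‖T x‖^4 <= <T x, x> <T T x, T x> <= c
    <T x, x> ‖T x‖^2, and ‖T x‖^2 cancels. As operators: T^2 <= c T. *)
Lemma symop_sqr_le T c : is_oper T -> 0 <= c -> symop b T -> posop b T ->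
  (forall x, b (T x) x <= c * b x x) -> forall x, b (T x) (T x) <= c * b (T x) x.
Proof.
move=> hT c0 sT pT le1 x.
have := ip_CS (form_inner hT sT pT) x (T x); rewrite /=.
have := le1 (T x); have := pT x; have := ip_ge0 b (T x).
set q := b (T x) (T x); set p := b (T x) x; set r := b (T (T x)) _.
move=> q0 p0 rq h; have [->|qn0] := eqVneq q 0; first by rewrite mulr_ge0.
have q_gt0 : 0 < q by rewrite lt_def qn0.
rewrite -(ler_pM2r q_gt0).
by rewrite (le_trans _ (_ : p * (c * q) <= _)) //; [|lra]; nra.
Qed.

End PositiveOperators.

Section CubicContraction.
Variables (R : realType) (V : lmodType R[i]) (b : inner V) (T : V -> V).
Hypotheses (hT : is_oper T) (sT : symop b T) (T1 : bddop b T 1).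

(* With v = T^2 this is v(1-v)^2 + (1-v)(1/2-v)^2 = (1-v)/4. *)
Lemma cubic_contraction x :
  b (T x - T (T (T x))) (T x - T (T (T x))) <= 4^-1 * b x x.
Proof.
have := T1 (2^-1%:C *: x - T (T x)); have := T1 x.
rewrite !(operB _ _ hT) !(operZ hT) !ipE expr1n !mul1r.
set t1 := T x; set t2 := T t1; set t3 := T t2.
have e1 : b x t2 = b t1 t1 by rewrite /t2 -sT.
have e2 : b t1 t3 = b t2 t2 by rewrite /t3 -sT.
by rewrite (ipC b t2 x) (ipC b t3 t1) !e1 !e2; move=> h1 h2; have := ip_ge0 b t1; lra.
Qed.

End CubicContraction.

(** * Polynomial approximate units *)

Section ApproximateUnit.
Variables (R : realType) (V : lmodType R[i]) (b : inner V) (Y : V -> V) (c : R).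
Hypotheses (hY : is_oper Y) (sY : symop b Y).
Hypotheses (c0 : 0 < c) (Yc : forall x, b (Y x) (Y x) <= c * b x x).

Let w x := x - c^-1%:C *: Y (Y x).

Lemma is_oper_w : is_oper w.
Proof.
split=> [x y|t x]; rewrite /w.
  by rewrite !(operD hY) scalerDr opprD addrACA.
by rewrite !(operZ hY) scalerA mulrC -scalerA scalerBr.
Qed.

Lemma comm_w x : Y (w x) = w (Y x).
Proof. by rewrite /w (operB _ _ hY) (operZ hY). Qed.

Lemma comm_iterw n x : Y (iter n w x) = iter n w (Y x).
Proof. by elim: n => //= n <-; rewrite comm_w. Qed.

Lemma symop_w : symop b w.
Proof. by move=> x y; rewrite /w !ipE !sY. Qed.

Lemma symop_iterw n : symop b (iter n w).
Proof. by elim: n => //= n IH x y; rewrite symop_w IH -iterSr. Qed.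

Lemma iterwD m n x : b (iter (m + n) w x) x = b (iter m w x) (iter n w x).
Proof. by rewrite addnC iterD symop_iterw. Qed.

Let moment n x := b (iter n w x) x.

(** An even power of [w] is the square of a symmetric operator; an odd one has a further factor [w],
    which is nonnegative since ‖Y y‖^2 <= c ‖y‖^2. *)
Lemma moment_ge0 n x : 0 <= moment n x.
Proof.
have w_ge0 y : 0 <= b (w y) y.
  rewrite /w !ipE sY subr_ge0 -[leRHS]mul1r -(mulVf (lt0r_neq0 c0)) -mulrA.
  by rewrite ler_wpM2l// invr_ge0 ltW.
rewrite /moment -[n]odd_double_half -addnn addnA iterwD.
by case: (odd n); rewrite ?ip_ge0//= w_ge0.
Qed.

Lemma moment_diff n x : moment n x - moment n.+1 x = c^-1 * moment n (Y x).
Proof.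
rewrite /moment iterSr [X in _ - X]symop_iterw {2}/w ipBl ipZl sY comm_iterw.
by rewrite -symop_iterw (ipC b (Y x)) opprB addrC subrK.
Qed.

Lemma moment_le m n x : (m <= n)%N -> moment n x <= moment m x.
Proof.
move=> /subnK <-; elim: (n - m)%N => // k; apply: le_trans.
by rewrite addSn -subr_ge0 moment_diff mulr_ge0 ?invr_ge0 ?(ltW c0)// moment_ge0.
Qed.

(** By [moment_diff] the sum of [moment k (Y x)] over k <= n telescopes to c (moment 0 x - moment
    (n+1) x), and each of its n + 1 terms is at least the last one. *)
Lemma moment_bound n x : n.+1%:R * moment n (Y x) <= c * b x x.
Proof.
suff h : n.+1%:R * moment n (Y x) <= c * (moment 0 x - moment n.+1 x).
  rewrite (le_trans h)// ler_wpM2l ?(ltW c0)//.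
  by rewrite -[b x x]/(moment 0 x) lerBlDr lerDl moment_ge0.
elim: n => [|n IH].
  by rewrite moment_diff mul1r mulrA mulfV ?mul1r// lt0r_neq0.
have -> : c * (moment 0 x - moment n.+2 x) = c * (moment 0 x - moment n.+1 x) + moment n.+1 (Y x).
  rewrite (_ : moment 0 x - moment n.+2 x =
      moment 0 x - moment n.+1 x + (moment n.+1 x - moment n.+2 x)).
    by rewrite mulrDr moment_diff mulrA mulfV ?mul1r// lt0r_neq0.
  by lra.
rewrite -[n.+2%:R]natr1 mulrDl mul1r lerD2r (le_trans _ IH)//.
by rewrite ler_wpM2l ?ler0n// moment_le.
Qed.

(* t^2 (1 - t^2/c)^(2n) <= c/(2n+1) on the spectrum of Y *)
Lemma approx_unit_mul n x :
  (n.*2.+1)%:R * b (Y (iter n w x)) (Y (iter n w x)) <= c * b x x.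
Proof. by rewrite comm_iterw -iterwD addnn; exact: moment_bound. Qed.

(** In terms of moments the left side is m_0 - 2 m_n + m_(2n), where 0 <= m_(2n) <= m_n. *)
Lemma approx_unit_contraction n x :
  b (x - iter n w x) (x - iter n w x) <= b x x.
Proof.
rewrite !ipE (ipC b x) -iterwD addnn -!/(moment _ _).
have := moment_ge0 n x; have : moment n.*2 x <= moment n x by rewrite moment_le// -addnn leq_addr.
lra.
Qed.

Lemma approx_unit_sym n : symop b (fun x => x - iter n w x).
Proof. by move=> x y; rewrite !ipE symop_iterw. Qed.

End ApproximateUnit.

(** * The real part of a complex inner product *)

Section HilbertInner.
Variables (R : realType) (H : hilbertSpace R).
Implicit Types x y z : H.

Lemma dotpDl x y z : dotp H (x + y) z = dotp H x z + dotp H y z.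
Proof. by rewrite linearDl. Qed.

Lemma dotpZl (a : R[i]) x z : dotp H (a *: x) z = a * dotp H x z.
Proof. by rewrite linearZl_LR. Qed.

Lemma dotpDr x y z : dotp H x (y + z) = dotp H x y + dotp H x z.
Proof. by rewrite linearDr. Qed.

Lemma dotpZr (a : R[i]) x z : dotp H x (a *: z) = Num.conj a * dotp H x z.
Proof. by rewrite linearZr_LR. Qed.

Lemma dotpC x y : dotp H x y = Num.conj (dotp H y x).
Proof. by rewrite (hermitian_subproof x y) expr0 mul1r. Qed.

Lemma dotp_ge0 x : 0 <= dotp H x x.
Proof. by rewrite -dotpE exprn_ge0. Qed.

Fact rdot_sym x y : complex.Re (dotp H x y) = complex.Re (dotp H y x).
Proof. by rewrite dotpC cRe_conj. Qed.

Fact rdotDl x y z : complex.Re (dotp H (x + y) z) =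
  complex.Re (dotp H x z) + complex.Re (dotp H y z).
Proof. by rewrite dotpDl cReD. Qed.

Fact rdotZl (t : R) x y : complex.Re (dotp H (t%:C *: x) y) =
  t * complex.Re (dotp H x y).
Proof. by rewrite dotpZl cRe_realM. Qed.

Fact rdot_ge0 x : 0 <= complex.Re (dotp H x x).
Proof. by rewrite cRe_ge0// dotp_ge0. Qed.

Definition rdot : inner H := Inner rdot_sym rdotDl rdotZl rdot_ge0.

Lemma rdotE x y : rdot x y = complex.Re (dotp H x y).
Proof. by []. Qed.

Lemma rdot_norm x : rdot x x = (complex.Re `|x|) ^+ 2.
Proof.
rewrite /rdot/= -dotpE; have := normr_ge0 x; case: `|x| => u v.
by rewrite lecE /= => /andP[/eqP-> _]; rewrite mul0r subr0 expr2.
Qed.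

Lemma rdot_eq0 x : rdot x x = 0 -> x = 0.
Proof.
rewrite rdot_norm => /eqP; rewrite sqrf_eq0 => /eqP e; apply/eqP.
rewrite -normr_eq0 eq_complex e eqxx/=; have := normr_ge0 x.
by rewrite lecE eq_sym => /andP[].
Qed.

Lemma rdot_ext x y : (forall z, rdot x z = rdot y z) -> x = y.
Proof.
by move=> h; apply/eqP; rewrite -subr_eq0; apply/eqP/rdot_eq0; rewrite ipBl !h subrr.
Qed.

(** The second argument of [dotp] is conjugate linear, so the imaginary part of <x, y> is the real
    part of <x, i y>. Complex identities can thus be checked on [rdot]. *)
Lemma dotp_rdot x y : dotp H x y = rdot x y +i* rdot x ('i%C *: y).
Proof.
rewrite /rdot/= dotpZr; case: (dotp H x y) => u v /=.
by rewrite mul0r sub0r mulN1r opprK.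
Qed.

Lemma rdotJ x y : rdot ('i%C *: x) y = - rdot x ('i%C *: y).
Proof.
rewrite /rdot/= dotpZl dotpZr; case: (dotp H x y) => u v /=.
by rewrite !mul0r !sub0r mulN1r mul1r opprK.
Qed.

Lemma hilbert_complete (u : nat -> H) :
  (forall e : R, 0 < e -> exists N, forall m n, (N <= m)%N -> (N <= n)%N ->
    rdot (u m - u n) (u m - u n) < e ^+ 2) ->
  exists x, forall e : R, 0 < e -> exists N, forall n, (N <= n)%N ->
    rdot (u n - x) (u n - x) < e ^+ 2.
Proof.
move=> uC.
have norm_lt z (e : R) : 0 < e -> (rdot z z < e ^+ 2) = (`|z| < e%:C).
  move=> e0; rewrite rdot_norm ltcE /=.
  have := normr_ge0 z; rewrite lecE => /andP[/eqP-> z0]; rewrite eqxx/=.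
  by rewrite ltr_pXn2r// nnegrE ltW.
have : cvg (u @ \oo).
  apply/cauchy_cvgP/cauchy_exP => e e0.
  have [er e_r] : exists er : R, e = er%:C.
    by move: e0; case: e => a b; rewrite ltcE/= => /andP[/eqP-> _]; exists a.
  move: e0; rewrite e_r ltcR => er0.
  have [N hN] := uC er er0.
  exists (u N); exists N => // n /= Nn.
  by rewrite -ball_normE /ball_/= -norm_lt// hN.
move=> /cvg_ex[x ux]; exists x => e e0.
move/cvgrPdist_lt: ux => /(_ e%:C); rewrite ltcR => /(_ e0)[N _ hN].
by exists N => n Nn; rewrite norm_lt// distrC hN.
Qed.

End HilbertInner.

#[global] Opaque rdot.

(** * The Riesz representation theorem and adjoints *)

Section Riesz.
Variables (R : realType) (H : hilbertSpace R) (l : H -> R) (c : R).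
Hypotheses (lD : forall x y, l (x + y) = l x + l y)
  (lZ : forall (t : R) x, l (t%:C *: x) = t * l x)
  (c0 : 0 <= c) (lc : forall x, l x ^+ 2 <= c * rdot H x x).

Let J x := rdot H x x - 2 * l x.

(** The hypothesis [lc] gives (2 l x)^2 <= 4 c ‖x‖^2 <= (c + ‖x‖^2)^2. *)
Lemma riesz_energy_ge x : - c <= J x.
Proof.
rewrite /J; have := lc x; have := ip_ge0 (rdot H) x; move: c0.
move: (rdot H x x) (l x) (c) => q a k k0 q0 h.
have [a0|a0] := leP a 0; first by lra.
have : (2 * a) ^+ 2 <= (k + q) ^+ 2 by have := sqr_ge0 (k - q); lra.
rewrite ler_pXn2r ?nnegrE//; lra.
Qed.

(* The representing vector is the limit of a minimising sequence of J; no
   subspace or orthogonal projection is needed. *)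
Lemma riesz : exists z, forall x, l x = rdot H x z.
Proof.
have infJ : has_inf (range J).
  by split; [exists (J 0), 0|exists (- c) => _ [x _ <-]; exact: riesz_energy_ge].
pose m := inf (range J).
have Jm x : m <= J x by apply: ge_inf; [case: infJ|exists x].
have ex_u (n : nat) : exists x, J x < m + n.+1%:R^-1.
  have [|_ [x _ <-] hx] := @inf_adherent _ (range J) n.+1%:R^-1 _ infJ; last by exists x.
  by rewrite invr_gt0.
have [u uP] := choice ex_u.
(* A near-minimiser almost represents [l]: J (x + t h) - m is a nonnegative quadratic in t whose
   constant term is below [d] and whose linear coefficient is twice the error at [h]. *)
have gap h x d : J x < m + d -> (rdot H x h - l h) ^+ 2 <= rdot H h h * d.
  move=> Jx; have d0 : 0 <= d by have := Jm x; lra.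
  apply: quad_discriminant; rewrite ?ip_ge0// => t.
  have := Jm (x + t%:C *: h).
  by move: Jx; rewrite /J !ipE lD lZ (ipC (rdot H) h x); lra.
have small (d : R) : 0 < d -> exists N, forall n, (N <= n)%N -> n.+1%:R^-1 < d.
  move=> d0; have [N _ hN] := near_infty_natSinv_lt (PosNum d0).
  exists N => n Nn; exact: hN.
have [e e0|z zP] := @hilbert_complete _ H u.
  (* By the parallelogram law ‖u_i - u_j‖^2 = 2 J u_i + 2 J u_j - 4 J ((u_i + u_j) / 2). As J is at
     least m at the midpoint, this is less than 4 (e^2 / 4). *)
  have [|N hN] := small (e ^+ 2 / 4); first by rewrite divr_gt0 ?exprn_gt0.
  exists N => i j Ni Nj.
  have := uP i; have := uP j; have := hN _ Ni; have := hN _ Nj.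
  have := Jm (2^-1%:C *: (u i + u j)).
  rewrite /J lZ lD !ipE (ipC (rdot H) (u j) (u i)).
  clearbody m; move: (i.+1%:R^-1) (j.+1%:R^-1) (e ^+ 2) => a b f. lra.
exists z => x; apply/eqP; rewrite eq_sym -subr_eq0 -sqrf_eq0 eq_le sqr_ge0 andbT.
apply/ler_addgt0Pr => e e0; rewrite add0r (ipC (rdot H) x z).
pose q := rdot H x x; have q0 : 0 <= q := ip_ge0 _ x.
(* This size makes q d <= e / 4. The errors <u_n, x> - l x and <u_n - z, x> both have square at most
   q d, so the square of their difference is at most 4 q d. *)
have d0 : 0 < e / (4 * (q + 1)) by rewrite divr_gt0//; lra.
have [|N1 hN1] := zP (Num.sqrt (e / (4 * (q + 1)))); first by rewrite sqrtr_gt0.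
have [N2 hN2] := small _ d0.
pose n := maxn N1 N2.
have := hN1 n (leq_maxl _ _); have := hN2 n (leq_maxr _ _).
rewrite sqr_sqrtr ?(ltW d0)//.
set d := (e / (4 * (q + 1))) => h2 h1.
have hd : q * d <= e / 4.
  rewrite /d (_ : q * _ = e / 4 * (q / (q + 1))); last by field; lra.
  by rewrite ler_piMr ?ler_pdivrMr; lra.
have h3 : (rdot H (u n) x - l x) ^+ 2 <= q * d.
  by apply: gap; rewrite (lt_trans (uP n))// ltrD2l.
have h4 : rdot H (u n - z) x ^+ 2 <= q * d.
  by rewrite (le_trans (ip_CS _ _ _))// mulrC ler_wpM2l// ltW.
rewrite ipBl in h4; move: h3 h4.
set a := rdot H (u n) x; set b := rdot H z x => h3 h4.
have := sqr_ge0 (a - l x + (a - b)); nra.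
Qed.

End Riesz.

(** * The ring of bounded operators and its involution *)

Section Bop.
Variables (R : realType) (H : hilbertSpace R).
Implicit Types (S T : bop H) (x y : H) (c : R).

Lemma bop_ext S T : S =1 T -> S = T.
Proof. by move=> h; apply: val_inj; apply/funext. Qed.

Lemma bop_lin T (a : R[i]) x y : T (a *: x + y) = a *: T x + T y.
Proof. by case: T => f /= /asboolP[h _]; rewrite h. Qed.

Lemma bopD T x y : T (x + y) = T x + T y.
Proof. by have := bop_lin T 1 x y; rewrite !scale1r. Qed.

Lemma bop0 T : T 0 = 0.
Proof. by have := bopD T 0 0; rewrite addr0 => /eqP; rewrite -subr_eq0 opprD addrA
  subrr sub0r oppr_eq0 => /eqP. Qed.

Lemma bopZ T (a : R[i]) x : T (a *: x) = a *: T x.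
Proof. by have := bop_lin T a x 0; rewrite !addr0 bop0 addr0. Qed.

Lemma is_oper_bop T : is_oper T.
Proof. by split=> *; rewrite ?bopD ?bopZ. Qed.

Lemma bopB T x y : T (x - y) = T x - T y.
Proof. exact: (operB _ _ (is_oper_bop T)). Qed.

Lemma bop_sum T (I : Type) (r : seq I) (P : pred I) (F : I -> H) :
  T (\sum_(i <- r | P i) F i) = \sum_(i <- r | P i) T (F i).
Proof. by elim/big_rec2: _ => [|i a b _ <-]; rewrite ?bop0 ?bopD. Qed.

Lemma add_bopE S T x : (S + T) x = S x + T x. Proof. by []. Qed.
Lemma sub_bopE S T x : (S - T) x = S x - T x. Proof. by []. Qed.
Lemma scale_bopE (a : R[i]) T x : (a *: T) x = a *: T x. Proof. by []. Qed.
Lemma zero_bopE x : (0 : bop H) x = 0. Proof. by []. Qed.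

Lemma sum_bopE (I : Type) (r : seq I) (P : pred I) (F : I -> bop H) x :
  (\sum_(i <- r | P i) F i) x = \sum_(i <- r | P i) F i x.
Proof. by elim/big_rec2: _ => // i a b _ <-. Qed.

Lemma bop_bounded T : exists2 c, 0 <= c & bddop (rdot H) T c.
Proof.
case: T => f /= /asboolP[_ [c hc]].
(* The constant [c] is any element of [R[i]]; on the zero space even its real part may be negative,
   hence the absolute value. *)
exists `|complex.Re c|; first exact: normr_ge0.
move=> x; rewrite !rdot_norm real_normK ?num_real// -exprMn.
have := hc x; have := normr_ge0 (f x); have := normr_ge0 x.
case: `|x| => u u'; case: `|f x| => v v'; case: c {hc} => a a' /=.
rewrite !lecE/= => /andP[/eqP-> u0] /andP[/eqP-> v0] /andP[_].
rewrite ?(mulr0, mul0r, subr0) => le1. by rewrite ler_pXn2r// nnegrE// (le_trans v0).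
Qed.

Lemma bounded_operatorP (f : H -> H) c :
  (forall (a : R[i]) x y, f (a *: x + y) = a *: f x + f y) -> 
  (forall x, rdot H (f x) (f x) <= c ^+ 2 * rdot H x x) ->
  f \in @bounded_operator R H.
Proof.
move=> flin fc; apply/asboolP; split; first exact: flin.
exists `|c|%:C => x; have := fc x.
rewrite !rdot_norm -[c ^+ 2]real_normK ?num_real// -exprMn.
have := normr_ge0 (f x); have := normr_ge0 x.
case: `|x| => u u'; case: `|f x| => v v' /=.
rewrite !lecE/= => /andP[/eqP-> u0] /andP[/eqP-> v0].
by rewrite ler_pXn2r ?nnegrE ?mulr_ge0// ?(mul0r, subr0, mulr0, addr0, eqxx).
Qed.

Lemma is_adjoint_rdot T S :
  is_adjoint T S <-> forall x y, rdot H (T x) y = rdot H x (S y).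
Proof.
split=> h x y; first by rewrite !rdotE h.
by rewrite !dotp_rdot !h bopZ.
Qed.

Lemma adjoint_exists T : exists S, is_adjoint T S.
Proof.
have [c c0 hc] := bop_bounded T.
have /choice[f hf] y : exists z, forall x, rdot H (T x) y = rdot H x z.
  apply: (@riesz _ _ (fun x => rdot H (T x) y) (c ^+ 2 * rdot H y y)).
  - by move=> u v; rewrite bopD ipDl.
  - by move=> t u; rewrite bopZ ipZl.
  - by rewrite mulr_ge0 ?sqr_ge0 ?ip_ge0.
  - move=> x; rewrite (le_trans (ip_CS _ _ _))//.
    by rewrite mulrAC ler_wpM2r ?ip_ge0.
(* Riesz has matched real parts only; compatibility with ['i] upgrades this to the complex inner
   product. *)
have fJ (x y : H) : rdot H (T x) ('i%C *: y) = rdot H x ('i%C *: f y).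
  by rewrite -[LHS]opprK -rdotJ -bopZ hf rdotJ opprK.
have fd (x y : H) : dotp H (T x) y = dotp H x (f y).
  by rewrite !dotp_rdot hf fJ.
have flin (a : R[i]) x y : f (a *: x + y) = a *: f x + f y.
  apply: rdot_ext => z; rewrite ipC [RHS]ipC.
  by rewrite !rdotE -fd !(dotpDr, dotpZr) !fd.
(* Since <T (f x), x> = ‖f x‖^2, Cauchy-Schwarz gives ‖f x‖^4 <= c^2 ‖f x‖^2 ‖x‖^2. *)
have fc x : rdot H (f x) (f x) <= c ^+ 2 * rdot H x x.
  have := ip_CS (rdot H) (T (f x)) x; rewrite hf => h1.
  have h2 := hc (f x); have := ip_ge0 (rdot H) (f x); move: h1 h2.
  move: (rdot H (f x) (f x)) (rdot H (T (f x)) _) (ip_ge0 (rdot H) x) => q r.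
  move: (rdot H x x) => s s0 h1 h2 q0.
  have [->|qn0] := eqVneq q 0; first by rewrite mulr_ge0 ?sqr_ge0.
  have q_gt0 : 0 < q by rewrite lt_def qn0.
  rewrite -(ler_pM2l q_gt0) -expr2 (le_trans h1)//.
  by rewrite mulrA [q * _]mulrC ler_wpM2r.
by exists (Bop (bounded_operatorP flin fc)) => x y; rewrite fd.
Qed.

Lemma dotp_adj T x y : dotp H (T x) y = dotp H x (adj T y).
Proof. by have [S hS] := adjoint_exists T; rewrite (xgetPex 0 (ex_intro _ S hS)). Qed.

Lemma rdot_adj T x y : rdot H (T x) y = rdot H x (adj T y).
Proof. by move: x y; apply/is_adjoint_rdot => x y; rewrite dotp_adj. Qed.

Lemma adj_unique T S : (forall x y, rdot H (T x) y = rdot H x (S y)) -> adj T = S.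
Proof.
move=> h; apply: bop_ext => y; apply: rdot_ext => x.
by rewrite ipC -rdot_adj h ipC.
Qed.

Lemma adj_bopK T : adj (adj T) = T.
Proof. by apply: adj_unique => x y; rewrite ipC -rdot_adj ipC. Qed.

Lemma adj_bopD S T : adj (S + T) = adj S + adj T.
Proof. by apply: adj_unique => x y; rewrite ipDl !rdot_adj ipDr. Qed.

Lemma adj_bopZ (a : R[i]) T : adj (a *: T) = Num.conj a *: adj T.
Proof.
apply: adj_unique; apply/is_adjoint_rdot => x y.
by rewrite !scale_bopE dotpZl dotp_adj dotpZr conjCK.
Qed.

Lemma adj_bop0 : adj (0 : bop H) = 0.
Proof. by apply: adj_unique => x y; rewrite ip0l ipC ip0l. Qed.

Lemma adj_bopM S T : adj (bop_comp S T) = bop_comp (adj T) (adj S).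
Proof. apply: adj_unique => x y; rewrite -[X in rdot H X]/(S (T x)) !rdot_adj. by []. Qed.

Lemma bop1_subproof : (id : H -> H) \in @bounded_operator R H.
Proof. by apply: (@bounded_operatorP _ 1) => // x; rewrite expr1n mul1r. Qed.

Definition bop1 : bop H := Bop bop1_subproof.

Lemma adj_bop1 : adj bop1 = bop1.
Proof. by apply: adj_unique. Qed.

Fact bop_compA : associative (@bop_comp R H).
Proof. by move=> S T U; apply: bop_ext. Qed.
Fact bop_comp1l : left_id bop1 (@bop_comp R H).
Proof. by move=> S; apply: bop_ext. Qed.
Fact bop_comp1r : right_id bop1 (@bop_comp R H).
Proof. by move=> S; apply: bop_ext. Qed.
Fact bop_compDl : left_distributive (@bop_comp R H) +%R.
Proof. by move=> S T U; apply: bop_ext. Qed.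
Fact bop_compDr : right_distributive (@bop_comp R H) +%R.
Proof. by move=> S T U; apply: bop_ext => x /=; rewrite bopD. Qed.

(** Provides [*m] for matrices of operators. The ring may be zero, as [H] may be the zero space. *)
HB.instance Definition _ := GRing.Zmodule_isPzRing.Build (bop H)
  bop_compA bop_comp1l bop_comp1r bop_compDl bop_compDr.

Lemma mul_bopE S T x : (S * T) x = S (T x). Proof. by []. Qed.

End Bop.

(** * Matrices of bounded operators *)

Section VectorInner.
Variables (R : realType) (H : hilbertSpace R) (d : nat).
Implicit Types (xi eta zeta : 'I_d -> H) (X Y : 'M[bop H]_d) (c : R).

Fact vdot_sym xi eta :
  \sum_i rdot H (xi i) (eta i) = \sum_i rdot H (eta i) (xi i).
Proof. by apply: eq_bigr => i _; rewrite ipC. Qed.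

Fact vdotDl xi eta zeta : \sum_i rdot H ((xi + eta) i) (zeta i) =
  \sum_i rdot H (xi i) (zeta i) + \sum_i rdot H (eta i) (zeta i).
Proof. by rewrite -big_split; apply: eq_bigr => i _; exact: ipDl. Qed.

Fact vdotZl (t : R) xi eta : \sum_i rdot H ((t%:C *: xi) i) (eta i) =
  t * \sum_i rdot H (xi i) (eta i).
Proof. by rewrite mulr_sumr; apply: eq_bigr => i _; exact: ipZl. Qed.

Fact vdot_ge0 xi : 0 <= \sum_i rdot H (xi i) (xi i).
Proof. by apply: sumr_ge0 => i _; exact: ip_ge0. Qed.

Definition vdot : inner ('I_d -> H) := Inner vdot_sym vdotDl vdotZl vdot_ge0.

Lemma vdotE xi eta : vdot xi eta = \sum_i rdot H (xi i) (eta i).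
Proof. by []. Qed.

Lemma vdot_eq0 xi : vdot xi xi = 0 -> xi = 0.
Proof.
rewrite vdotE => /eqP; rewrite psumr_eq0; last by move=> i _; exact: ip_ge0.
move=> /allP h; apply/funext => i; apply: rdot_eq0.
by apply/eqP/(h i); rewrite mem_index_enum.
Qed.

Lemma vdotJ xi eta : vdot ('i%C *: xi) eta = - vdot xi ('i%C *: eta).
Proof. by rewrite !vdotE -sumrN; apply: eq_bigr => i _; exact: rdotJ. Qed.

Lemma vdot_cZl (t : R[i]) xi eta : vdot (t *: xi) eta = vdot xi (Num.conj t *: eta).
Proof.
rewrite !vdotE; apply: eq_bigr => i _.
by rewrite !rdotE dotpZl dotpZr conjCK.
Qed.

Lemma vnorm_ge0 xi : 0 <= vnorm xi.
Proof. exact: sqrtr_ge0. Qed.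

Lemma vnorm0 : vnorm (0 : 'I_d -> H) = 0.
Proof. by rewrite /vnorm big1 ?sqrtr0// => i _; rewrite normr0 expr0n. Qed.

Lemma sqr_vnorm xi : vnorm xi ^+ 2 = vdot xi xi.
Proof.
rewrite /vnorm sqr_sqrtr; first by apply: eq_bigr => i _; rewrite rdot_norm.
by apply: sumr_ge0 => i _; rewrite sqr_ge0.
Qed.

Lemma mx_actD X xi eta : mx_act X (xi + eta) = mx_act X xi + mx_act X eta.
Proof.
apply/funext => i; rewrite /mx_act -[RHS]big_split.
by apply: eq_bigr => j _; exact: bopD.
Qed.

Lemma mx_actZ X (a : R[i]) xi : mx_act X (a *: xi) = a *: mx_act X xi.
Proof.
apply/funext => i; rewrite /mx_act [RHS]scaler_sumr.
by apply: eq_bigr => j _; exact: bopZ.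
Qed.

Lemma is_oper_mx X : is_oper (mx_act X).
Proof. by split=> *; rewrite ?mx_actD ?mx_actZ. Qed.

Lemma add_mx_act X Y xi : mx_act (X + Y) xi = mx_act X xi + mx_act Y xi.
Proof.
by apply/funext => i; rewrite /mx_act -[RHS]big_split; apply: eq_bigr => j _; rewrite mxE.
Qed.

Lemma opp_mx_act X xi : mx_act (- X) xi = - mx_act X xi.
Proof.
by apply/funext => i; rewrite /mx_act -[RHS]sumrN; apply: eq_bigr => j _; rewrite mxE.
Qed.

Lemma sub_mx_act X Y xi : mx_act (X - Y) xi = mx_act X xi - mx_act Y xi.
Proof. by rewrite add_mx_act opp_mx_act. Qed.

Lemma scale_mx_act (a : R[i]) X xi : mx_act (map_mx ( *:%R a) X) xi = a *: mx_act X xi.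
Proof.
apply/funext => i; rewrite /mx_act [RHS]scaler_sumr.
by apply: eq_bigr => j _; rewrite mxE.
Qed.

Lemma mul_mx_act X Y xi : mx_act (X *m Y) xi = mx_act X (mx_act Y xi).
Proof.
apply/funext => i; rewrite /mx_act.
under eq_bigr do rewrite mxE sum_bopE.
rewrite exchange_big; apply: eq_bigr => k _ /=.
by rewrite bop_sum.
Qed.

Lemma mx_act_ext X Y : mx_act X =1 mx_act Y -> X = Y.
Proof.
move=> h; apply/matrixP => i j; apply: bop_ext => x.
have := congr1 (fun f => f i) (h (fun k => if k == j then x else 0)).
rewrite /mx_act (bigD1 j)//= eqxx big1 ?addr0; last first.
  by move=> k /negPf->; rewrite bop0.
rewrite (bigD1 j)//= eqxx big1 ?addr0// => k /negPf->.
by rewrite bop0.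
Qed.

Definition mxadj X : 'M[bop H]_d := (map_mx (@adj _ H) X)^T.

Lemma vdot_adj X xi eta : vdot (mx_act X xi) eta = vdot xi (mx_act (mxadj X) eta).
Proof.
rewrite !vdotE.
have sum_l (F : 'I_d -> H) y : rdot H (\sum_j F j) y = \sum_j rdot H (F j) y.
  by elim/big_rec2: _ => [|i a b _ <-]; rewrite ?ip0l ?ipDl.
under eq_bigr do rewrite sum_l.
rewrite exchange_big; apply: eq_bigr => j _ /=.
rewrite [RHS](ipC (rdot H)) sum_l; apply: eq_bigr => i _.
by rewrite rdot_adj (ipC (rdot H)) !mxE.
Qed.

Lemma vdot_ext xi eta : (forall z, vdot xi z = vdot eta z) -> xi = eta.
Proof.
by move=> h; apply/eqP; rewrite -subr_eq0; apply/eqP/vdot_eq0; rewrite ipBl !h subrr.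
Qed.

Lemma symop_adj X : symop vdot (mx_act X) <-> mxadj X = X.
Proof.
split=> [h|h xi eta]; last by rewrite vdot_adj h.
apply: mx_act_ext => xi; apply: vdot_ext => eta.
by rewrite ipC -vdot_adj h ipC.
Qed.

Lemma symop_im X : symop vdot (mx_act X) -> forall xi,
  vdot (mx_act X xi) ('i%C *: xi) = 0.
Proof.
move=> h xi; have := vdotJ (mx_act X xi) xi; rewrite -mx_actZ h ipC.
by move=> e; lra.
Qed.

(** The order of [R[i]] makes a nonnegative form real on every vector; evaluating its imaginary part
    at xi - i eta polarises this into symmetry of [X]. *)
Lemma op_mxposP X :
  op_mxpos X <-> symop vdot (mx_act X) /\ posop vdot (mx_act X).
Proof.
have formE xi : \sum_(i < d) dotp H (mx_act X xi i) (xi i) =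
    vdot (mx_act X xi) xi +i* vdot (mx_act X xi) ('i%C *: xi).
  rewrite !vdotE; under eq_bigr do rewrite dotp_rdot.
  by elim/big_rec3: _ => // i a b c _ ->.
split=> [h|[sX pX] xi]; last first.
  by rewrite formE lecE; apply/andP; split; [apply/eqP/symop_im|exact: pX].
split=> [xi eta|xi]; last by have := h xi; rewrite formE lecE => /andP[].
have im0 z : vdot (mx_act X z) ('i%C *: z) = 0.
  by have := h z; rewrite formE lecE => /andP[/eqP].
have := im0 (xi - 'i%C *: eta).
rewrite (operB _ _ (is_oper_mx X)) mx_actZ scalerBr scalerA -expr2 sqr_i scaleN1r.
have := im0 xi; have := im0 eta; rewrite !ipE !vdotJ.
rewrite scalerA -expr2 sqr_i scaleN1r ipNr (ipC vdot xi) => -> ->; lra.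
Qed.

Lemma mx_act_bounded X : exists2 c, 0 <= c & bddop vdot (mx_act X) c.
Proof.
pose F i j := projT1 (cid2 (bop_bounded (X i j))).
have F0 i j : 0 <= F i j by rewrite /F; case: cid2.
have FP i j x : rdot H (X i j x) (X i j x) <= F i j ^+ 2 * rdot H x x.
  by rewrite /F; case: cid2 => c /= _; apply.
(* A crude constant suffices: ‖u + v‖^2 <= 2 ‖u‖^2 + 2 ‖v‖^2 doubles it at each term. *)
have sum_le (n : nat) (G : 'I_n -> H) :
    rdot H (\sum_i G i) (\sum_i G i) <= 2 ^+ n * \sum_i rdot H (G i) (G i).
  elim: n G => [|n IH] G; first by rewrite !big_ord0 ip0l mulr0.
  rewrite !big_ord_recr/=; move: (IH (fun i => G (widen_ord (leqnSn n) i))).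
  move: (\sum_(i < n) _) (\sum_(i < n) _) (G ord_max) => s u v h.
  have := ip_ge0 (rdot H) (u - v); have := ip_ge0 (rdot H) v.
  rewrite !ipE (ipC (rdot H) v u) exprS.
  have : 1 <= 2 ^+ n :> R by rewrite exprn_ege1// ler1n.
  move: (2 ^+ n) h => N h N1 h1 h2.
  have : rdot H v v <= N * rdot H v v by rewrite ler_peMl.
  lra.
pose K := \sum_i \sum_j F i j ^+ 2.
have K0 : 0 <= K by apply: sumr_ge0 => i _; apply: sumr_ge0 => j _; rewrite sqr_ge0.
exists (Num.sqrt (2 ^+ d * K)) => [|xi]; first exact: sqrtr_ge0.
rewrite sqr_sqrtr ?mulr_ge0// -mulrA vdotE mulr_suml mulr_sumr.
apply: ler_sum => i _; rewrite (le_trans (sum_le _ _))// ler_wpM2l//.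
rewrite mulr_suml; apply: ler_sum => j _; rewrite (le_trans (FP _ _ _))//.
rewrite ler_wpM2l ?sqr_ge0// vdotE (bigD1 j)//= lerDl sumr_ge0// => k _.
exact: ip_ge0.
Qed.

(** Replaces the supremum over the unit ball by a homogeneous inequality between squares, the form
    in which matrix norms are estimated from here on. *)
Lemma op_mxnorm_leP X t : 0 <= t -> op_mxnorm X <= t <-> bddop vdot (mx_act X) t.
Proof.
move=> t0; split=> h; last first.
  apply: ge_sup; first by exists (vnorm (mx_act X 0)), 0 => //=; rewrite vnorm0.
  move=> _ [xi xi1 <-]; rewrite -(@ler_pXn2r _ 2) ?nnegrE ?vnorm_ge0//.
  rewrite sqr_vnorm (le_trans (h xi))// ler_piMr ?sqr_ge0// -sqr_vnorm.
  by rewrite expr_le1// vnorm_ge0.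
(* Boundedness ensures that [sup] is a true upper bound and not a default value. *)
have [c c0 hc] := mx_act_bounded X.
have le_xi xi : vnorm xi <= 1 -> vnorm (mx_act X xi) <= t.
  move=> xi1; apply: le_trans h; apply: ub_le_sup; last by exists xi.
  exists c => _ [eta eta1 <-]; rewrite -(@ler_pXn2r _ 2) ?nnegrE ?vnorm_ge0//.
  rewrite sqr_vnorm (le_trans (hc eta))// ler_piMr ?sqr_ge0// -sqr_vnorm.
  by rewrite expr_le1// vnorm_ge0.
move=> xi; have [/vdot_eq0->|xi0] := eqVneq (vdot xi xi) 0.
  have := operZ (is_oper_mx X) 0 0; rewrite scaler0 rmorph0 scale0r => ->.
  by rewrite ip0l mulr0.
pose s := vnorm xi; have s0 : 0 < s.
  by rewrite lt_def vnorm_ge0 andbT -sqrf_eq0 sqr_vnorm.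
have h1 : vnorm ((s^-1)%:C *: xi) <= 1.
  rewrite -(@ler_pXn2r _ 2) ?nnegrE ?vnorm_ge0// sqr_vnorm !ipE -sqr_vnorm -/s.
  by rewrite expr1n (_ : _ * _ = 1)//; field; rewrite gt_eqF.
have := le_xi _ h1; rewrite mx_actZ -(@ler_pXn2r _ 2) ?nnegrE ?vnorm_ge0//.
by rewrite sqr_vnorm !ipE -[vdot xi xi]sqr_vnorm -/s mulrA -invfM -expr2 mulrC
  ler_pdivrMr ?exprn_gt0.
Qed.

Lemma op_mxnorm_ge0 X : 0 <= op_mxnorm X.
Proof.
have [c c0 hc] := mx_act_bounded X.
apply: le_trans (vnorm_ge0 (mx_act X 0)) _.
apply: ub_le_sup; last first.
  by exists 0 => //=; rewrite vnorm0.
exists c => _ [eta eta1 <-]; rewrite -(@ler_pXn2r _ 2) ?nnegrE ?vnorm_ge0//.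
rewrite sqr_vnorm (le_trans (hc eta))// ler_piMr ?sqr_ge0// -sqr_vnorm.
by rewrite expr_le1// vnorm_ge0.
Qed.

Lemma op_mxnorm_bound X : bddop vdot (mx_act X) (op_mxnorm X).
Proof. by apply/op_mxnorm_leP => //; exact: op_mxnorm_ge0. Qed.

End VectorInner.

Arguments vdot {R H d}.
#[global] Opaque vdot.

(** * Positive semidefinite matrices *)

Section PsdMatrices.
Variables (R : realType) (d : nat).
Local Notation C := R[i].
Implicit Types (A B : 'M[C]_d) (u v : 'cV[C]_d).

Definition ctr m n (A : 'M[C]_(m, n)) : 'M[C]_(n, m) := (map_mx Num.conj A)^T.

Lemma ctrM m n p (A : 'M[C]_(m, n)) (B : 'M[C]_(n, p)) : ctr (A *m B) = ctr B *m ctr A.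
Proof. by rewrite /ctr map_mxM trmx_mul. Qed.

Lemma ctrK m n (A : 'M[C]_(m, n)) : ctr (ctr A) = A.
Proof. by apply/matrixP => i j; rewrite !mxE conjCK. Qed.

Lemma ctrD m n (A B : 'M[C]_(m, n)) : ctr (A + B) = ctr A + ctr B.
Proof. by rewrite /ctr map_mxD linearD. Qed.

Lemma ctr_scalar (t : R) : ctr ((t%:C)%:M : 'M[C]_d) = (t%:C)%:M.
Proof. by rewrite /ctr map_scalar_mx tr_scalar_mx /= conj_real. Qed.

(** Polarisation again: the form is real at delta_i + delta_j and at delta_i + i delta_j, which
    forces [A i j] and [A j i] to be conjugate. *)
Lemma psd_herm A : psdmx A -> ctr A = A.
Proof.
move=> psdA; pose f u v := (ctr u *m A *m v) 0 0.
have fe i j : f (delta_mx i 0) (delta_mx j 0) = A i j.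
  rewrite /f (_ : ctr _ = delta_mx 0 i); last first.
    by apply/matrixP => k l; rewrite !mxE andbC rmorph_nat.
  by rewrite -rowE -colE !mxE.
have fD u v : f (u + v) (u + v) = f u u + f v v + (f u v + f v u).
  by rewrite /f ctrD mulmxDl mulmxDr !mulmxDl !mxE addrACA [X in _ + X]addrC addrACA.
have fZ (a : C) u v : f (a *: u) v = Num.conj a * f u v.
  rewrite /f (_ : ctr (a *: u) = Num.conj a *: ctr u).
    by rewrite -!scalemxAl mxE.
  by apply/matrixP => i j; rewrite !mxE rmorphM.
have fZr (a : C) u v : f u (a *: v) = a * f u v.
  by rewrite /f -scalemxAr mxE.
have im0 u v : complex.Im (f u v + f v u) = 0.
  have := psdA (u + v); rewrite -/(f _ _) fD.
  have := psdA u; have := psdA v; rewrite -!/(f _ _).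
  case: (f u u) (f v v) (_ + f v u) => [a b] [a' b'] [a2 b2].
  rewrite !lecE/= => /andP[/eqP-> _] /andP[/eqP-> _] /andP[/eqP].
  by rewrite !add0r.
apply/matrixP => i j; rewrite !mxE -!fe.
set u := delta_mx i 0; set v := delta_mx j 0.
have := im0 u v; have := im0 u ('i%C *: v); rewrite fZ fZr.
case: (f u v) (f v u) => [a b] [a' b'] /=.
rewrite !mul0r !mul1r ?add0r ?sub0r ?oppr0 ?subr0 ?addr0 => e1 e2.
by apply/eqP; rewrite eq_complex/=; apply/andP; split; apply/eqP; lra.
Qed.

Lemma psd_sqrt A : psdmx A -> exists S, psdmx S /\ S *m S = A.
Proof.
move=> psdA; have hA := psd_herm psdA.
have Ah : A \is hermsymmx.
  by apply/is_hermitianmxP; rewrite expr0 scale1r -[LHS]hA /ctr map_trmx.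
have /orthomx_spectralP := hermitian_normalmx Ah.
set P := spectralmx A; set D := spectral_diag A => eA.
have Pu : P \is unitarymx := spectral_unitarymx A.
have iP : invmx P = ctr P by rewrite invmx_unitary// /ctr map_trmx.
have Punit := unitarymx_unit Pu.
have PPc : P *m ctr P = 1%:M by rewrite -iP mulmxV.
rewrite iP in eA.
have D0 i : 0 <= D 0 i.
  have := psdA (ctr P *m delta_mx i 0); rewrite -/(ctr _) ctrM ctrK eA.
  rewrite !mulmxA -(mulmxA _ P (ctr P)) PPc mulmx1.
  rewrite -(mulmxA _ P (ctr P)) PPc mulmx1.
  rewrite (_ : ctr _ = delta_mx 0 i); last first.
    by apply/matrixP => k l; rewrite !mxE andbC rmorph_nat.
  by rewrite -rowE -colE !mxE eqxx.
pose Q : 'M[C]_d := diag_mx (map_mx sqrtC D).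
exists (ctr P *m Q *m P); split; last first.
  have QQ : Q *m Q = diag_mx D.
    by rewrite mulmx_diag; congr diag_mx; apply/rowP => i; rewrite !mxE -expr2 sqrtCK.
  by rewrite !mulmxA -(mulmxA _ P (ctr P)) PPc mulmx1 -(mulmxA _ Q Q) QQ -eA.
move=> v; rewrite -/(ctr v) !mulmxA -(mulmxA _ P v) -mulmxA -[v in ctr v]mul1mx.
have -> : ctr (1%:M *m v) *m ctr P = ctr (P *m v) by rewrite mul1mx ctrM.
set w := P *m v; rewrite mulmxA mxE; apply: sumr_ge0 => i _.
rewrite mul_mx_diag !mxE mulrAC mulr_ge0// ?sqrtC_ge0// mulrC.
exact: mul_conjC_ge0.
Qed.

(** For a row vector u in the kernel, 0 = u A u^* + e u u^* is a sum of nonnegative terms, so u u^*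
    = 0. *)
Lemma psd_shift_unit A (e : R) : psdmx A -> 0 < e -> A + (e%:C)%:M \in unitmx.
Proof.
move=> psdA e0; rewrite -row_free_unit -kermx_eq0; apply/eqP.
apply/row_matrixP => k; rewrite row0; set u := row k _.
have uA : u *m (A + (e%:C)%:M) = 0 by rewrite -row_mul mulmx_ker row0.
have : (u *m (A + (e%:C)%:M) *m ctr u) 0 0 = 0 by rewrite uA mul0mx mxE.
have -> : (u *m (A + (e%:C)%:M) *m ctr u) 0 0 =
    (u *m A *m ctr u) 0 0 + e%:C * (u *m ctr u) 0 0.
  by rewrite mulmxDr mulmxDl mul_mx_scalar -scalemxAl !mxE.
have := psdA (ctr u); rewrite -/(ctr _) ctrK => h0 h.
have h1 : 0 <= (u *m ctr u) 0 0.
  by rewrite mxE; apply: sumr_ge0 => i _; rewrite !mxE mul_conjC_ge0.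
have e0' : 0 < e%:C by rewrite ltcR.
have : (u *m ctr u) 0 0 = 0.
  apply/eqP; rewrite eq_le h1 andbT -(pmulr_rle0 _ e0') -h.
  by rewrite lerDr.
rewrite mxE => /eqP; rewrite psumr_eq0; last by move=> i _; rewrite !mxE mul_conjC_ge0.
move=> /allP h2; apply/rowP => i; have := h2 i (mem_index_enum i).
by rewrite !mxE mul_conjC_eq0 => /eqP.
Qed.

Lemma psd_shift A (e : R) : psdmx A -> 0 <= e -> psdmx (A + (e%:C)%:M).
Proof.
move=> psdA e0 v; rewrite -/(ctr v) mulmxDr mulmxDl mxE addr_ge0//; first exact: psdA.
rewrite mul_mx_scalar -scalemxAl mxE mulr_ge0 ?ler0c// mxE sumr_ge0// => i _.
by rewrite !mxE mulrC mul_conjC_ge0.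
Qed.

(** The inverse of a positive definite matrix is positive and hence has a positive square root; so
    [invsqrtmx] is a genuine root and not the default value of [xget]. *)
Lemma invsqrtmxP A (e : R) : psdmx A -> 0 < e ->
  psdmx (invsqrtmx (A + (e%:C)%:M)) /\
  invsqrtmx (A + (e%:C)%:M) *m invsqrtmx (A + (e%:C)%:M) *m (A + (e%:C)%:M) = 1%:M.
Proof.
move=> psdA e0; set M := A + _.
have Mu : M \in unitmx by exact: psd_shift_unit.
have psdM : psdmx M by apply: psd_shift => //; exact: ltW.
have psdI : psdmx (invmx M).
  move=> v; rewrite -/(ctr v); have -> : v = M *m (invmx M *m v).
    by rewrite mulmxA mulmxV// mul1mx.
  set w := invmx M *m v; rewrite ctrM (psd_herm psdM).
  rewrite -[ctr w *m M *m invmx M]mulmxA mulmxV// mulmx1 mulmxA; exact: psdM.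
have [S hS] := psd_sqrt psdI.
have [p q] : [set B | psdmx B /\ B *m B = invmx M] (invsqrtmx M).
  by rewrite /invsqrtmx; case: xgetP => [B _ []//|/(_ S)].
by split=> //; rewrite q mulVmx.
Qed.

End PsdMatrices.

(** * Scalar matrices as operators on H^d *)

Section ScalarOperators.
Variables (R : realType) (H : hilbertSpace R).
Local Notation C := R[i].

Definition smx d (A : 'M[C]_d) : 'M[bop H]_d := map_mx (fun a => a *: (1 : bop H)) A.

Lemma smxM d (A B : 'M[C]_d) : smx (A *m B) = smx A *m smx B.
Proof.
apply/matrixP => i j; rewrite !mxE; apply: bop_ext => x.
rewrite sum_bopE scale_bopE scaler_suml; apply: eq_bigr => k _.
by rewrite !mxE mul_bopE !scale_bopE scalerA.
Qed.

Lemma smxD d (A B : 'M[C]_d) : smx (A + B) = smx A + smx B.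
Proof. by apply/matrixP => i j; rewrite !mxE scalerDl. Qed.

Lemma mxadj_smx d (A : 'M[C]_d) : mxadj (smx A) = smx (ctr A).
Proof. by apply/matrixP => i j; rewrite !mxE/= adj_bopZ [adj _]adj_bop1. Qed.

Lemma smx_scalar_act d (t : C) (xi : 'I_d -> H) : mx_act (smx t%:M) xi = t *: xi.
Proof.
apply/funext => i; rewrite /mx_act (bigD1 i)//= !mxE eqxx mulr1n big1 ?addr0//.
by move=> j ji; rewrite !mxE eq_sym (negPf ji) mulr0n scale0r.
Qed.

Lemma sandwich_smx d (B : 'M[C]_d) (X : 'M[bop H]_d) :
  mx_sandwich B X = smx B *m X *m smx B.
Proof.
apply/matrixP => i j; rewrite !mxE exchange_big; apply: eq_bigr => l _ /=.
rewrite !mxE mulr_suml; apply: eq_bigr => k _; rewrite !mxE.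
by apply: bop_ext => x; rewrite !(scale_bopE, mul_bopE, bopZ) scalerA.
Qed.

Lemma map_sandwich (V W : lmodType C) (f : {linear V -> W}) d (B : 'M[C]_d) (X : 'M[V]_d) :
  map_mx f (mx_sandwich B X) = mx_sandwich B (map_mx f X).
Proof.
apply/matrixP => i j; rewrite !mxE linear_sum; apply: eq_bigr => k _.
by rewrite linear_sum; apply: eq_bigr => l _; rewrite linearZ mxE.
Qed.

Lemma psd_op_mxpos d (A : 'M[C]_d) : psdmx A -> op_mxpos (smx A).
Proof.
move=> psdA; apply/op_mxposP; split.
  by apply/symop_adj; rewrite mxadj_smx psd_herm.
have [S [psdS <-]] := psd_sqrt psdA.
move=> xi; rewrite smxM mul_mx_act vdot_adj mxadj_smx psd_herm//.
exact: ip_ge0.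
Qed.

Definition cdot d (xi eta : 'I_d -> H) : C := \sum_i dotp H (xi i) (eta i).

Lemma cdotE d (xi eta : 'I_d -> H) : cdot xi eta = vdot xi eta +i* vdot xi ('i%C *: eta).
Proof.
rewrite !vdotE /cdot; under eq_bigr do rewrite dotp_rdot.
by elim/big_rec3: _ => // i a b c _ ->.
Qed.

Lemma cdotDl d (xi eta zeta : 'I_d -> H) : cdot (xi + eta) zeta = cdot xi zeta + cdot eta zeta.
Proof. by rewrite -big_split; apply: eq_bigr => i _; exact: dotpDl. Qed.

Lemma cdotZl d (a : C) (xi eta : 'I_d -> H) : cdot (a *: xi) eta = a * cdot xi eta.
Proof. by rewrite /cdot mulr_sumr; apply: eq_bigr => i _; exact: dotpZl. Qed.

(** Multiplying [xi] by the conjugate of z = <xi, eta> turns the pairing into the real number |z|^2,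
    to which the real Cauchy-Schwarz inequality applies. *)
Lemma cdot_CS d (xi eta : 'I_d -> H) : `|cdot xi eta| <= (vnorm xi * vnorm eta)%:C.
Proof.
set z := cdot xi eta.
have [r0 rE] : 0 <= complex.Re `|z| /\ `|z| = (complex.Re `|z|)%:C.
  have := normr_ge0 z; case: `|z| => a b; rewrite lecE/= => /andP[/eqP-> a0].
  by split.
rewrite rE lecR; set r := complex.Re `|z| in r0 rE *.
have z2 : Num.conj z * z = (r ^+ 2)%:C.
  by rewrite mulrC -sqr_normc rE -rmorphXn.
have e1 : vdot (Num.conj z *: xi) eta = r ^+ 2.
  have := cdotZl (Num.conj z) xi eta; rewrite -/z z2 cdotE.
  by move=> [].
have e2 : vdot (Num.conj z *: xi) (Num.conj z *: xi) = r ^+ 2 * vdot xi xi.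
  by rewrite vdot_cZl scalerA conjCK mulrC z2 (ipC vdot xi) ipZl.
have := ip_CS vdot (Num.conj z *: xi) eta; rewrite e1 e2 -!sqr_vnorm => h.
have [->|rn0] := eqVneq r 0; first by rewrite mulr_ge0 ?vnorm_ge0.
have r_gt0 : 0 < r by rewrite lt_def rn0.
rewrite -(@ler_pXn2r _ 2) ?nnegrE ?mulr_ge0 ?vnorm_ge0// exprMn.
by move: h; rewrite [(r ^+ 2) ^+ 2]expr2 -(mulrA (r ^+ 2) (vnorm xi ^+ 2)) ler_pM2l ?exprn_gt0.
Qed.

Lemma normc_le_Re (z : C) (t : R) : `|z| <= t%:C -> - t <= complex.Re z <= t.
Proof.
move=> zt; have := le_trans (normc_ge_Re z) zt.
by rewrite lecR ler_norml.
Qed.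

End ScalarOperators.

(** * Vector states, and operator positivity of positive elements of the unitization *)

Section VectorStates.
Variables (R : realType) (H : hilbertSpace R) (E : operatorSystem H).
Local Notation C := R[i].

Fact os_val_linear : linear (@os_val _ _ E).
Proof. by []. Qed.

HB.instance Definition _ := GRing.isLinear.Build C (os_elt E) (bop H) *:%R
  (@os_val _ _ E) os_val_linear.

Definition vmx d (X : 'M[E]_d) : 'M[bop H]_d := map_mx (@os_val _ _ E) X.

Lemma vmxD d (X Y : 'M[E]_d) : vmx (X + Y) = vmx X + vmx Y.
Proof. by apply/matrixP => i j; rewrite !mxE. Qed.

Lemma vmxB d (X Y : 'M[E]_d) : vmx (X - Y) = vmx X - vmx Y.
Proof. by apply/matrixP => i j; rewrite !mxE. Qed.

Lemma vmxZ d (a : C) (X : 'M[E]_d) : vmx (map_mx ( *:%R a) X) = map_mx ( *:%R a) (vmx X).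
Proof. by apply/matrixP => i j; rewrite !mxE. Qed.

Lemma vmx_sandwich d B (X : 'M[E]_d) : vmx (mx_sandwich B X) = smx H B *m vmx X *m smx H B.
Proof. by exact: etrans (map_sandwich (@os_val _ _ E) B X) (sandwich_smx _ _). Qed.

Lemma vector_state d (xi : 'I_d -> H) : vnorm xi <= 1 ->
  quasistate (fun Y : 'M[E]_d => cdot (mx_act (vmx Y) xi) xi).
Proof.
move=> xi1; split=> [a X Y|X pX|X].
- by rewrite vmxD vmxZ add_mx_act scale_mx_act cdotDl cdotZl.
- exact: pX.
- apply: le_trans (cdot_CS _ _) _; rewrite lecR.
  rewrite (le_trans (ler_piMr (vnorm_ge0 _) xi1))//.
  rewrite -(@ler_pXn2r _ 2) ?nnegrE ?vnorm_ge0 ?op_mxnorm_ge0//.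
  rewrite sqr_vnorm (le_trans (op_mxnorm_bound _ _))// ler_piMr ?sqr_ge0//.
  by rewrite -sqr_vnorm expr_le1// vnorm_ge0.
Qed.

Lemma sharp_mxstarP d (Z : 'M[sharp_sort E]_d) : sharp_mxstar Z = Z <->
  mxadj (vmx (map_mx fst Z)) = vmx (map_mx fst Z) /\
  ctr (map_mx snd Z : 'M[C]_d) = map_mx snd Z.
Proof.
split=> [h|[h1 h2]].
  by split; apply/matrixP => i j; rewrite -[in RHS]h !mxE.
apply/matrixP => i j; rewrite !mxE [RHS]surjective_pairing; congr pair.
  apply: val_inj; have := congr1 (fun M : 'M[bop H]_d => M i j) h1.
  by rewrite !mxE.
by have := congr1 (fun M : 'M[C]_d => M i j) h2; rewrite !mxE.
Qed.

(** Vector states suffice for this direction, for every operator system. Given eta, put xi = B M eta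
    with M = A + e1 and B = M^(-1/2), so that B xi = eta. The vector state of xi / ‖xi‖ then yields
    <X eta, eta> >= - ‖xi‖^2 = - <A eta, eta> - e1 ‖eta‖^2. *)
Lemma sharp_pos_op_mxpos d (Z : 'M[sharp_sort E]_d) : sharp_pos Z ->
  op_mxpos (vmx (map_mx fst Z) + smx H (map_mx snd Z)).
Proof.
case=> /sharp_mxstarP[]; set X := map_mx fst Z; set A : 'M[C]_d := map_mx snd Z.
move=> hX hA psdA hphi; apply/op_mxposP; split.
  apply/symop_adj; rewrite -[in RHS]hX -[in RHS]hA -mxadj_smx.
  by apply/matrixP => i j; rewrite !mxE adj_bopD.
move=> eta; rewrite add_mx_act ipDl; apply/ler_addgt0Pr => e e0.
(* Chosen so that e1 ‖eta‖^2 <= e; the [+ 1] allows eta = 0. *)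
pose e1 := e / (vdot eta eta + 1).
have q0 := ip_ge0 vdot eta.
have e10 : 0 < e1 by rewrite divr_gt0// ltr_wpDl.
have [psdB BBC] := invsqrtmxP psdA e10.
set B := invsqrtmx _ in psdB BBC *; set M := A + _ in B psdB BBC *.
pose xi := mx_act (smx H (B *m M)) eta.
have hB := psd_herm psdB.
have Bxi : mx_act (smx H B) xi = eta.
  rewrite /xi -mul_mx_act -smxM mulmxA BBC.
  by have := smx_scalar_act (1 : C) eta; rewrite scale1r.
have xi2 : vdot xi xi = vdot (mx_act (smx H A) eta) eta + e1 * vdot eta eta.
  rewrite {1}/xi smxM mul_mx_act vdot_adj mxadj_smx hB Bxi.
  by rewrite /M smxD add_mx_act smx_scalar_act ipDl ipZl.
have key : - vdot xi xi <= vdot (mx_act (vmx X) eta) eta.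
  have [xi0|xi0] := eqVneq (vdot xi xi) 0.
    have -> : eta = 0.
      rewrite -Bxi (vdot_eq0 xi0).
      by have := mx_actZ (smx H B) 0 xi; rewrite !scale0r.
    have -> : mx_act (vmx X) 0 = 0.
      by have := mx_actZ (vmx X) 0 0; rewrite !scale0r.
    by rewrite ip0l oppr_le0 ip_ge0.
  pose s := vnorm xi; have s0 : 0 < s.
    by rewrite lt_def vnorm_ge0 andbT -sqrf_eq0 sqr_vnorm.
  pose u := (s^-1)%:C *: xi.
  have u1 : vnorm u <= 1.
    rewrite -(@ler_pXn2r _ 2) ?nnegrE ?vnorm_ge0// sqr_vnorm !ipE -sqr_vnorm -/s.
    by rewrite expr1n (_ : _ * _ = 1)//; field; rewrite gt_eqF.
  have := hphi e1 _ e10 (vector_state u1).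
  rewrite -/A -/M -/B -/X vmx_sandwich cdotE/= !mul_mx_act vdot_adj mxadj_smx hB.
  have -> : mx_act (smx H B) u = (s^-1)%:C *: eta by rewrite /u mx_actZ Bxi.
  rewrite mx_actZ !ipE -[vdot xi xi]sqr_vnorm -/s; move: (vdot _ _) => v h.
  have := ler_wpM2l (sqr_ge0 s) h; rewrite mulrN1.
  by rewrite (_ : s ^+ 2 * _ = v)//; field; rewrite gt_eqF.
rewrite xi2 in key.
have : e1 * vdot eta eta <= e by rewrite /e1 mulrAC ler_pdivrMr; nra.
lra.
Qed.

End VectorStates.

(** * Quasistates on matrices over a C*-algebra *)

Section QuasistateBound.
Variables (R : realType) (K : hilbertSpace R) (A : cstarAlgebra K).
Local Notation C := R[i].

Definition cs_mul (x y : A) : A := OsElt (cs_comp (os_valP x) (os_valP y)).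

Definition cs_mulmx d (X Y : 'M[A]_d) : 'M[A]_d :=
  \matrix_(i, j) \sum_k cs_mul (X i k) (Y k j).

Lemma vmx_mulmx d (X Y : 'M[A]_d) : vmx (cs_mulmx X Y) = vmx X *m vmx Y.
Proof.
apply/matrixP => i j; rewrite !mxE (linear_sum (@os_val _ _ A)).
by apply: eq_bigr => k _; rewrite !mxE.
Qed.

(* With e = 1 - (1 - Y^2/c)^n, which lies in M_d(A) although 1 need not, Y is
   norm-close to e Y e >= - e^2, and e is a contraction. *)
Lemma quasistate_ge d (Y : 'M[A]_d) (phi : 'M[A]_d -> C) : quasistate phi ->
  mxadj (vmx Y) = vmx Y ->
  (forall xi, - vdot xi xi <= vdot (mx_act (vmx Y) xi) xi) ->
  -1 <= complex.Re (phi Y).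
Proof.
move=> [phiL phi_ge0 phi_le] hY Y1.
have phiD X Z : phi (X + Z) = phi X + phi Z.
  have := phiL 1 X Z; rewrite mul1r (_ : map_mx _ X = X)//.
  by apply/matrixP => i j; rewrite mxE scale1r.
have [c0 c00 hc] := mx_act_bounded (vmx Y).
set T := mx_act (vmx Y) in Y1 hc.
have hT : is_oper T := is_oper_mx _.
have sT : symop vdot T by apply/symop_adj.
pose c := c0 ^+ 2 + 1.
have c_gt0 : 0 < c by rewrite ltr_wpDl ?sqr_ge0.
have Tc xi : vdot (T xi) (T xi) <= c * vdot xi xi.
  by rewrite (le_trans (hc xi))// ler_wpM2r ?ip_ge0// lerDl.
pose v := map_mx ( *:%R ((c^-1)%:C)) (cs_mulmx Y Y).
(* With v = Y^2 / c this is 1 - (1 - v)^(n+1) = v + (1 - v) (1 - (1 - v)^n), written without the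
   unit so that it stays in M_d(A). *)
pose e n := iter n (fun e => v + e - cs_mulmx v e) (0 : 'M[A]_d).
pose w xi := xi - (c^-1)%:C *: T (T xi).
have vE xi : mx_act (vmx v) xi = (c^-1)%:C *: T (T xi).
  by rewrite /v vmxZ scale_mx_act vmx_mulmx mul_mx_act.
have eE n xi : mx_act (vmx (e n)) xi = xi - iter n w xi.
  elim: n => [|n IH].
    rewrite /= subrr; apply/funext => i; rewrite /mx_act big1// => j _.
    by rewrite !mxE.
  rewrite /= vmxB vmxD vmx_mulmx sub_mx_act add_mx_act mul_mx_act IH !vE.
  rewrite !(operB _ _ hT) scalerBr opprB.
  by rewrite addrC addrA subrK addrCA {3}/w opprB.
have inv2 (t : R) : 0 < t -> exists n, 4 * c <= t * (n.*2.+1)%:R.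
  move=> t0; exists (Num.truncn (4 * c / t)).+1.
  rewrite [_ * _%:R]mulrC -ler_pdivrMr//; have := truncnS_gt (4 * c / t).
  by move=> /ltW h; rewrite (le_trans h)// ler_nat -addnn ltnS (leq_trans (leqnSn _))// leq_addr.
apply/ler_addgt0Pr => eps eps0.
(* For this n, [approx_unit_mul] gives ‖Y w^n‖ <= eps / 2. *)
have [n hn] := inv2 (eps ^+ 2) (exprn_gt0 2 eps0).
pose EYE := cs_mulmx (e n) (cs_mulmx Y (e n)).
pose EE := cs_mulmx (e n) (e n).
have rT xi : T (iter n w xi) = iter n w (T xi) := comm_iterw c hT n xi.
have hw : is_oper w := is_oper_w c hT.
have wB x y : iter n w (x - y) = iter n w x - iter n w y.
  by elim: (n) => //= k ->; rewrite (operB _ _ hw).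
have contr xi : vdot (xi - iter n w xi) (xi - iter n w xi) <= vdot xi xi.
  exact: (approx_unit_contraction hT sT c_gt0 Tc).
have small xi : 4 * vdot (T (iter n w xi)) (T (iter n w xi)) <= eps ^+ 2 * vdot xi xi.
  have N0 : 0 < (n.*2.+1)%:R :> R by rewrite ltr0n.
  have := approx_unit_mul hT sT c_gt0 Tc n xi; move: (ip_ge0 vdot xi) N0 hn.
  move: (n.*2.+1%:R) => N.
  move: (vdot (T _) _) (vdot xi xi) => a q q0 N0 hn h.
  rewrite -(ler_pM2l N0).
  have : 4 * c * q <= eps ^+ 2 * N * q by rewrite ler_wpM2r.
  lra.
have normY : op_mxnorm (vmx (Y - EYE)) <= eps.
  apply/op_mxnorm_leP; first exact: ltW.
  move=> xi; rewrite vmxB sub_mx_act !vmx_mulmx !mul_mx_act -/T !eE -/T.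
  rewrite (operB _ _ hT); set a := T (iter n w xi).
  (* With a = Y w^n xi, the difference of Y xi and e Y e xi is a + e a, of norm at most 2 ‖a‖
     because e is a contraction. *)
  have -> : T xi - (T xi - a - iter n w (T xi - a)) = a + (a - iter n w a).
    by rewrite wB -rT -/a opprD opprK addrA subKr.
  have := contr a; have := small xi; rewrite -/a; set b := a - iter n w a => h1 h2.
  clearbody b; clearbody a; have := ip_ge0 vdot (a - b); rewrite !ipE (ipC _ b a); lra.
have normEE : op_mxnorm (vmx EE) <= 1.
  apply/op_mxnorm_leP => // x; rewrite vmx_mulmx mul_mx_act !eE expr1n mul1r.
  exact: le_trans (contr _) (contr _).
(* This element is e (Y + 1) e, so phi (e Y e) >= - phi (e^2) >= - ‖e^2‖ >= -1 in real parts. *)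
have posS : op_mxpos (vmx (EYE + EE)).
  have eS : symop vdot (mx_act (vmx (e n))).
    by move=> x y; rewrite !eE; exact: (approx_unit_sym c sT n).
  apply/op_mxposP; split=> [x y|x].
    rewrite vmxD !add_mx_act !vmx_mulmx !mul_mx_act !ipE.
    by rewrite !eS -/T sT eS.
  rewrite vmxD !add_mx_act !vmx_mulmx !mul_mx_act !ipE 2!eS -/T.
  by have := Y1 (mx_act (vmx (e n)) x); lra.
have h1 := normc_le_Re (phi_le (Y - EYE)).
have h2 := normc_le_Re (phi_le EE).
have := phi_ge0 (EYE + EE) posS; rewrite phiD => /cRe_ge0; rewrite cReD => h3.
have : complex.Re (phi Y) = complex.Re (phi (Y - EYE)) + complex.Re (phi EYE).
  by rewrite -cReD -phiD subrK.
move: h1 h2; rewrite -/(vmx _) -!/(op_mxnorm _) => /andP[h1 _] /andP[_ h2].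
have h1' : - eps <= complex.Re (phi (Y - EYE)).
  by apply: le_trans h1; rewrite lerN2.
have h2' : complex.Re (phi EE) <= 1 := le_trans h2 normEE.
lra.
Qed.
End QuasistateBound.

(** * Norm limits of bounded operators *)

Section OperatorLimits.
Variables (R : realType) (H : hilbertSpace R).
Implicit Types (x y : H) (S T : bop H) (c e : R).

Definition rnorm x : R := complex.Re `|x|.

Lemma rnormE x : `|x| = (rnorm x)%:C.
Proof.
rewrite /rnorm; have := normr_ge0 x; case: `|x| => a b.
by rewrite lecE/= => /andP[/eqP->].
Qed.

Lemma rnorm_ge0 x : 0 <= rnorm x.
Proof. exact/cRe_ge0/normr_ge0. Qed.

Lemma rnormD x y : rnorm (x + y) <= rnorm x + rnorm y.
Proof. by have := ler_normD x y; rewrite !rnormE -rmorphD lecR. Qed.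

Lemma rnormB x y : rnorm (x - y) <= rnorm x + rnorm y.
Proof. by have := ler_normB x y; rewrite !rnormE -rmorphD lecR. Qed.

Lemma rnorm_sub x y : rnorm (x - y) = rnorm (y - x).
Proof. by rewrite /rnorm distrC. Qed.

Lemma rnormZ (a : R[i]) x : rnorm (a *: x) = complex.Re `|a| * rnorm x.
Proof.
rewrite /rnorm normrZ [`|x|]rnormE; have := normr_ge0 a; case: `|a| => u v.
by rewrite lecE/= => /andP[/eqP-> _]; rewrite mul0r subr0.
Qed.

Lemma rnorm_eq0 x : (forall e, 0 < e -> rnorm x <= e) -> x = 0.
Proof.
move=> h; apply/eqP; rewrite -normr_eq0 rnormE eq_complex/= eqxx andbT eq_le rnorm_ge0 andbT.
by apply/ler_addgt0Pr => e /h; rewrite add0r.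
Qed.

Lemma rdot_rnorm x : rdot H x x = rnorm x ^+ 2.
Proof. exact: rdot_norm. Qed.

Lemma rdot_le x y : `|rdot H x y| <= rnorm x * rnorm y.
Proof.
rewrite -(@ler_pXn2r _ 2) ?nnegrE ?mulr_ge0 ?rnorm_ge0// real_normK ?num_real//.
by rewrite exprMn -!rdot_rnorm ip_CS.
Qed.

Lemma bddopP (f : H -> H) c : 0 <= c ->
  bddop (rdot H) f c <-> forall x, rnorm (f x) <= c * rnorm x.
Proof.
move=> c0; split=> h x; have := h x; rewrite !rdot_rnorm -exprMn.
  by rewrite ler_pXn2r// nnegrE ?mulr_ge0 ?rnorm_ge0.
by move=> hx; rewrite ler_pXn2r// nnegrE ?mulr_ge0 ?rnorm_ge0.
Qed.

Lemma mx1_act T (xi : 'I_1 -> H) : mx_act (const_mx T) xi = fun=> T (xi ord0).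
Proof. by apply/funext => i; rewrite /mx_act big_ord1 mxE. Qed.

Lemma vdot1 (xi eta : 'I_1 -> H) : vdot xi eta = rdot H (xi ord0) (eta ord0).
Proof. by rewrite vdotE big_ord1. Qed.

(** As [rdot] sees only the real part of <T x, x>, symmetry is a separate condition. *)
Definition bpos T := symop (rdot H) T /\ posop (rdot H) T.

Lemma bposP T : op_mxpos (const_mx T : 'M[bop H]_1) <-> bpos T.
Proof.
split=> [/op_mxposP[h1 h2]|[h1 h2]]; [|apply/op_mxposP]; split.
- by move=> x y; have := h1 (fun=> x) (fun=> y); rewrite !mx1_act !vdot1.
- by move=> x; have := h2 (fun=> x); rewrite !mx1_act !vdot1.
- by move=> x y; rewrite !mx1_act !vdot1.
- by move=> x; rewrite !mx1_act !vdot1.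
Qed.

Lemma opnorm_leP T c : 0 <= c ->
  opnorm T <= c <-> forall x, rnorm (T x) <= c * rnorm x.
Proof.
move=> c0; split.
  move/op_mxnorm_leP => /(_ c0) h; apply/bddopP => // x.
  by have := h (fun=> x); rewrite !mx1_act !vdot1.
move/bddopP => /(_ c0) h; apply/op_mxnorm_leP => // xi.
by rewrite !mx1_act !vdot1.
Qed.

Lemma opnorm_ge0 T : 0 <= opnorm T.
Proof. exact: op_mxnorm_ge0. Qed.

Lemma opnormP T x : rnorm (T x) <= opnorm T * rnorm x.
Proof. by move: x; apply/opnorm_leP; rewrite ?opnorm_ge0. Qed.

Lemma opnormD S T : opnorm (S + T) <= opnorm S + opnorm T.
Proof.
apply/opnorm_leP; first by rewrite addr_ge0 ?opnorm_ge0.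
by move=> x; rewrite add_bopE (le_trans (rnormD _ _))// mulrDl lerD ?opnormP.
Qed.

Lemma opnormZ (t : R[i]) T : opnorm (t *: T) <= complex.Re `|t| * opnorm T.
Proof.
have t0 : 0 <= complex.Re `|t| := cRe_ge0 (normr_ge0 t).
apply/opnorm_leP; first by rewrite mulr_ge0 ?opnorm_ge0.
by move=> x; rewrite scale_bopE rnormZ -mulrA ler_wpM2l ?opnormP.
Qed.

Lemma opnorm_sub S T : opnorm (S - T) = opnorm (T - S).
Proof.
by apply/eqP; rewrite eq_le; apply/andP; split; apply/opnorm_leP;
  rewrite ?opnorm_ge0// => x; rewrite sub_bopE rnorm_sub -sub_bopE opnormP.
Qed.

Lemma opnormB S T : opnorm (S - T) <= opnorm S + opnorm T.
Proof.
apply/opnorm_leP; first by rewrite addr_ge0 ?opnorm_ge0.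
by move=> x; rewrite sub_bopE (le_trans (rnormB _ _))// mulrDl lerD ?opnormP.
Qed.

Lemma bop_complete (u : nat -> bop H) :
  (forall e, 0 < e -> exists N, forall m n, (N <= m)%N -> (N <= n)%N ->
    opnorm (u m - u n) <= e) ->
  exists T, forall e, 0 < e -> exists N, forall n, (N <= n)%N ->
    opnorm (u n - T) <= e.
Proof.
move=> uC.
have ulim x : exists y, forall e : R, 0 < e -> exists N, forall n, (N <= n)%N ->
    rnorm (u n x - y) <= e.
  have [e e0|y hy] := @hilbert_complete _ H (fun n => u n x).
    have x0 := rnorm_ge0 x.
    have [|N hN] := uC (e / (2 * (rnorm x + 1))); first by rewrite divr_gt0//; lra.
    exists N => m n Nm Nn; rewrite rdot_rnorm ltr_pXn2r ?nnegrE ?rnorm_ge0 ?ltW//.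
    have := opnormP (u m - u n) x; rewrite sub_bopE => h.
    apply: le_lt_trans h _.
    apply: le_lt_trans (_ : e / (2 * (rnorm x + 1)) * rnorm x < _).
      by rewrite ler_wpM2r// hN.
    by rewrite mulrAC ltr_pdivrMr; nra.
  exists y => e e0; have [N hN] := hy e e0; exists N => n Nn.
  have := hN n Nn; rewrite rdot_rnorm ltr_pXn2r ?nnegrE ?rnorm_ge0 ?(ltW e0)//.
  exact: ltW.
have [f fP] := choice ulim.
(* The pointwise limit is uniform on balls: comparison goes through an auxiliary [u m] whose index
   may depend on [x], while [N] does not. *)
have fu e : 0 < e -> exists N, forall n, (N <= n)%N -> forall x,
    rnorm (u n x - f x) <= e * rnorm x.
  move=> e0; have [N hN] := uC e e0; exists N => n Nn x.
  apply/ler_addgt0Pr => d d0; have [N' hN'] := fP x d d0.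
  pose m := maxn N N'.
  have h1 := opnormP (u n - u m) x.
  have h2 := hN' m (leq_maxr _ _).
  have h3 := hN n m Nn (leq_maxl _ _).
  rewrite -(subrK (u m x) (u n x)) -addrA (le_trans (rnormD _ _))// lerD//.
  by rewrite (le_trans h1)// ler_wpM2r ?rnorm_ge0.
have flin (a : R[i]) x y : f (a *: x + y) = a *: f x + f y.
  apply/eqP; rewrite -subr_eq0; apply/eqP/rnorm_eq0 => e e0.
  pose r := complex.Re `|a|; have r0 : 0 <= r := cRe_ge0 (normr_ge0 a).
  have x0 := rnorm_ge0 x; have y0 := rnorm_ge0 y; have z0 := rnorm_ge0 (a *: x + y).
  (* The defect of linearity of [f] is at most e / s times s - 1. *)
  pose s := rnorm (a *: x + y) + (r * rnorm x + rnorm y) + 1.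
  have s0 : 0 < s by rewrite /s; nra.
  have [|N hN] := fu (e / s); first by rewrite divr_gt0.
  pose T := u N; have {hN} hT z : rnorm (f z - T z) <= e / s * rnorm z.
    by rewrite rnorm_sub hN.
  have -> : f (a *: x + y) - (a *: f x + f y) =
      (f (a *: x + y) - T (a *: x + y)) - (a *: (f x - T x) + (f y - T y)).
    by rewrite bopD bopZ scalerBr addrACA -opprD opprB addrA subrK.
  apply: le_trans (rnormB _ _) _.
  apply: le_trans (lerD (hT _) (rnormD _ _)) _.
  have hx := hT x; have hy := hT y; rewrite rnormZ -/r.
  have : e / s * (s - 1) <= e.
    by rewrite mulrAC ler_pdivrMr// ler_wpM2l ?ltW//; lra.
  have := ler_wpM2l r0 hx; rewrite [s - 1]addrK; move: (e / s) hx hy => k; lra.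
have [N hN] := fu 1 ltr01.
have fbd x : rdot H (f x) (f x) <= (opnorm (u N) + 1) ^+ 2 * rdot H x x.
  have c0 : 0 <= opnorm (u N) + 1 by rewrite addr_ge0// opnorm_ge0.
  move: x; apply/bddopP => // x.
  rewrite -(subrK (u N x) (f x)) (le_trans (rnormD _ _))// addrC mulrDl lerD ?opnormP//.
  by rewrite rnorm_sub hN.
exists (Bop (bounded_operatorP flin fbd)) => e e0.
have [M hM] := fu e e0; exists M => n Mn.
by apply/opnorm_leP => [|x]; [exact: ltW|exact: hM].
Qed.

Lemma bpos_limit T : (forall e, 0 < e -> exists2 S, bpos S & opnorm (S - T) <= e) -> bpos T.
Proof.
move=> h; split=> [x y|x].
  apply/eqP; rewrite -subr_eq0 -normr_le0; apply/ler_addgt0Pr => e e0; rewrite add0r.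
  have x0 := rnorm_ge0 x; have y0 := rnorm_ge0 y.
  pose s := 2 * (rnorm x * rnorm y) + 1.
  have s0 : 0 < s by rewrite /s; nra.
  have [|S [sS _] hS] := h (e / s); first by rewrite divr_gt0.
  have es0 : 0 <= e / s by rewrite divr_ge0 ?ltW.
  have hd z : rnorm (T z - S z) <= e / s * rnorm z.
    rewrite rnorm_sub -sub_bopE (le_trans (opnormP _ _))// ler_wpM2r// rnorm_ge0//.
  have -> : rdot H (T x) y - rdot H x (T y) =
      rdot H (T x - S x) y - rdot H x (T y - S y) by rewrite !ipE sS; lra.
  rewrite (le_trans (ler_normB _ _))//.
  apply: le_trans (lerD (rdot_le _ _) (rdot_le _ _)) _.
  have h1 := ler_wpM2r y0 (hd x); have h2 := ler_wpM2l x0 (hd y).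
  have : e / s * (s - 1) <= e.
    by rewrite mulrAC ler_pdivrMr// ler_wpM2l ?ltW//; lra.
  move: h1 h2; rewrite [s - 1]addrK; move: (e / s) => k; lra.
apply/ler_addgt0Pr => e e0; have x0 := rnorm_ge0 x.
pose s := rnorm x * rnorm x + 1; have s0 : 0 < s by rewrite /s; nra.
have [|S [_ pS] hS] := h (e / s); first by rewrite divr_gt0.
have := pS x; have := rdot_le (S x - T x) x; rewrite ler_norml => /andP[_].
rewrite ipBl => h1 h2.
have h3 : rnorm (S x - T x) * rnorm x <= e / s * (s - 1).
  rewrite /s addrK mulrA ler_wpM2r// -sub_bopE (le_trans (opnormP _ _))// ler_wpM2r//.
have : e / s * (s - 1) <= e.
  by rewrite mulrAC ler_pdivrMr// ler_wpM2l ?ltW//; lra.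
lra.
Qed.

End OperatorLimits.

(** * Positive decompositions in C*-algebras *)

Section PositiveDecomposition.
Variables (R : realType) (K : hilbertSpace R) (A : cstarAlgebra K).
Implicit Types (x y : A).

Lemma bddop1P (f : K -> K) : bddop (rdot K) f 1 <-> forall v, rnorm (f v) <= rnorm v.
Proof.
split=> h v.
  by have := (bddopP f ler01).1 h v; rewrite mul1r.
by apply: (bddopP f ler01).2 => u; rewrite mul1r.
Qed.

Lemma rnormZr (t : R) (v : K) : 0 <= t -> rnorm (t%:C *: v) = t * rnorm v.
Proof. by move=> t0; rewrite rnormZ ger0_norm ?ler0c. Qed.

Lemma cs_mulE x y (v : K) : os_val (cs_mul x y) v = os_val x (os_val y v).
Proof. by []. Qed.

Lemma bop_half_sqrB (T : bop K) (v : K) :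
  let h (u : K) := (2^-1)%:C *: (T (T u) + T u) in
  let k (u : K) := (2^-1)%:C *: (T (T u) - T u) in
  h (h v) - k (k v) = T (T (T v)).
Proof.
move=> h k; rewrite /h /k; apply: rdot_ext => z.
rewrite !(bopB, bopD, bopZ); move: (T (T (T (T v)))) (T (T (T v))) (T (T v)) => a b c.
rewrite !ipE; lra.
Qed.

(** For a self-adjoint contraction x, [cubic_contraction] gives ‖x - x^3‖ <= 1/2, so the factor 2 is
    the one that keeps the iterates contractions. *)
Let step x : A := 2%:C *: (x - cs_mul x (cs_mul x x)).
Let half x : A := (2^-1)%:C *: (cs_mul x x + x).
Let halfm x : A := (2^-1)%:C *: (cs_mul x x - x).

Section Contraction.
Variable x : A.
Hypotheses (sx : symop (rdot K) (os_val x)) (bx : forall v : K, rnorm (os_val x v) <= rnorm v).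

Lemma step_sym : symop (rdot K) (os_val (step x)).
Proof. by move=> u v; rewrite /= !ipE !sx. Qed.

Lemma step_contr (v : K) : rnorm (os_val (step x) v) <= rnorm v.
Proof.
have := cubic_contraction (is_oper_bop (os_val x)) sx ((bddop1P _).2 bx) v.
rewrite -[os_val (step x) v]/(2%:C *: (os_val x v - os_val x (os_val x (os_val x v)))).
rewrite rnormZr// !rdot_rnorm; set a := rnorm _; set b := rnorm v => h.
rewrite -(@ler_pXn2r _ 2) ?nnegrE ?mulr_ge0 ?rnorm_ge0//.
by rewrite exprMn; lra.
Qed.

Lemma half_contr (v : K) : rnorm (os_val (half x) v) <= rnorm v.
Proof.
rewrite -[os_val (half x) v]/((2^-1)%:C *: (os_val x (os_val x v) + os_val x v)).
rewrite rnormZr ?invr_ge0//.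
have := rnormD (os_val x (os_val x v)) (os_val x v).
have := bx v; have := bx (os_val x v); lra.
Qed.

Lemma half_sqr_pos : bpos (os_val (cs_mul (half x) (half x))).
Proof.
have sh : symop (rdot K) (os_val (half x)) by move=> u v; rewrite /= !ipE !sx.
split=> [u v|u]; first by rewrite !cs_mulE !sh.
by rewrite cs_mulE sh ip_ge0.
Qed.

Lemma halfm_sqr_pos : bpos (os_val (cs_mul (halfm x) (halfm x))).
Proof.
have sh : symop (rdot K) (os_val (halfm x)) by move=> u v; rewrite /= !ipE !sx.
split=> [u v|u]; first by rewrite !cs_mulE !sh.
by rewrite cs_mulE sh ip_ge0.
Qed.

End Contraction.

Lemma half_sqrB x : cs_mul (half x) (half x) - cs_mul (halfm x) (halfm x) =
  cs_mul x (cs_mul x x).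
Proof.
apply: val_inj; apply: bop_ext => v; exact: (bop_half_sqrB (os_val x) v).
Qed.

(* For a_0 = x and a_(k+1) = 2 (a_k - a_k^3), which remain contractions,
   x = sum_k 2^-k a_k^3, and a^3 = ((a^2 + a)/2)^2 - ((a^2 - a)/2)^2. *)
Lemma contraction_pos_decomp x : symop (rdot K) (os_val x) ->
  (forall v : K, rnorm (os_val x v) <= rnorm v) ->
  exists p n : A, [/\ x = p - n, bpos (os_val p) & bpos (os_val n)].
Proof.
move=> sx bx; pose a k := iter k step x.
have sa k : symop (rdot K) (os_val (a k)) /\
    forall v : K, rnorm (os_val (a k) v) <= rnorm v.
  by elim: k => [//|k [s b]]; split; [exact: step_sym|exact: step_contr].
have pos_sum n (f : nat -> A) : (forall k, bpos (os_val (f k))) ->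
    bpos (os_val (\sum_(k < n) (2^-1 ^+ k)%:C *: f k)).
  move=> fp; elim: n => [|n [IHs IHp]].
    by rewrite big_ord0; split=> [u v|u]; rewrite ?zero_bopE ?ip0l// ipC ip0l.
  have [s p] := fp n; rewrite big_ord_recr/=; split=> [u v|u].
    by rewrite !add_bopE !scale_bopE !ipE IHs s.
  rewrite add_bopE scale_bopE ipDl ipZl; apply: addr_ge0; first exact: IHp.
  by apply: mulr_ge0; [rewrite exprn_ge0 ?invr_ge0|exact: p].
pose p k := cs_mul (half (a k)) (half (a k)).
pose n k := cs_mul (halfm (a k)) (halfm (a k)).
pose P m := \sum_(k < m) (2^-1 ^+ k)%:C *: p k.
pose N m := \sum_(k < m) (2^-1 ^+ k)%:C *: n k.
have PS m : P m.+1 = P m + (2^-1 ^+ m)%:C *: p m by rewrite /P big_ord_recr.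
have NS m : N m.+1 = N m + (2^-1 ^+ m)%:C *: n m by rewrite /N big_ord_recr.
have aS m : a m.+1 = 2%:C *: (a m - cs_mul (a m) (cs_mul (a m) (a m))) by [].
(* The remainder satisfies 2^-m (a_m - a_m^3) = 2^-(m+1) a_(m+1): the factor 2 of [step] is absorbed
   by the next weight. *)
have telescope m : P m - N m = x - (2^-1 ^+ m)%:C *: a m.
  elim: m => [|m IH]; first by rewrite /P /N !big_ord0 scale1r !subrr.
  rewrite PS NS aS opprD addrACA IH -scalerBr half_sqrB scalerA.
  have -> : (2^-1 ^+ m.+1)%:C * 2%:C = (2^-1 ^+ m)%:C :> R[i].
    by rewrite -rmorphM/= exprSr -mulrA mulVf// mulr1.
  by rewrite scalerBr opprB [RHS]addrA addrAC.
(* The right side is the geometric sum of the weights 2^-k for m <= k < m + j, each multiplying a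
   square of norm at most 1. *)
have cauchyP m j : opnorm (os_val (P (m + j)%N) - os_val (P m)) <=
    2 * 2^-1 ^+ m - 2 * 2^-1 ^+ (m + j).
  have half_le i : 2^-1 ^+ (m + i) <= 2^-1 ^+ m :> R.
    by rewrite ler_wiXn2l ?invr_ge0 ?invf_le1 ?ler1n// leq_addr.
  elim: j => [|j IH].
    rewrite addn0 !subrr; apply/opnorm_leP => // v.
    by rewrite zero_bopE mul0r /rnorm normr0.
  have -> : os_val (P (m + j.+1)%N) - os_val (P m) =
      (os_val (P (m + j)%N) - os_val (P m)) + (2^-1 ^+ (m + j))%:C *: os_val (p (m + j)%N).
    by rewrite addnS PS addrAC.
  apply: le_trans (opnormD _ _) _; apply: le_trans (lerD IH (opnormZ _ _)) _.
  have h0 : 0 <= 2^-1 ^+ (m + j) :> R by rewrite exprn_ge0 ?invr_ge0.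
  rewrite ger0_norm ?ler0c//= addnS exprS.
  have : opnorm (os_val (p (m + j)%N)) <= 1.
    apply/opnorm_leP => // v; rewrite mul1r /p cs_mulE.
    have [s b] := sa (m + j)%N.
    by rewrite (le_trans (half_contr b _))// half_contr.
  move/(ler_wpM2l h0); lra.
have small2 (e : R) : 0 < e -> exists M, forall m, (M <= m)%N -> 2 * 2^-1 ^+ m <= e.
  move=> e0; exists (Num.truncn (2 / e)).+1 => m Mm.
  rewrite exprVn ler_pdivrMr ?exprn_gt0// mulrC -ler_pdivrMr//.
  have /ltW h := truncnS_gt (2 / e); rewrite (le_trans h)//.
  by rewrite -natrX ler_nat (leq_trans Mm)// ltnW// ltn_expl.
have cauchyP2 (e : R) : 0 < e -> exists M, forall m, (M <= m)%N -> forall j,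
    opnorm (os_val (P (m + j)%N) - os_val (P m)) <= e.
  move=> e0; have [M hM] := small2 e e0; exists M => m Mm j.
  rewrite (le_trans (cauchyP m j))// (le_trans _ (hM m Mm))//.
  by rewrite gerBl mulr_ge0// exprn_ge0 ?invr_ge0.
have [e e0|T hT] := @bop_complete _ K (fun m => os_val (P m)).
  have [M hM] := cauchyP2 e e0; exists M => m k Mm Mk.
  have [mk|/ltnW km] := leqP m k; last by rewrite -(subnKC km) hM.
  by rewrite opnorm_sub -(subnKC mk) hM.
have TA : T \in os_pred A.
  apply: os_closed => e e0; have [|M hM] := hT (e / 2); first by lra.
  exists (os_val (P M)); first exact: os_valP.
  by rewrite opnorm_sub (le_lt_trans (hM M (leqnn M)))//; lra.
pose pT : A := OsElt TA.
(* Only the series of the P m needs its own limit: by [telescope] the N m converge to [pT - x],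
   which is therefore positive. *)
exists pT, (pT - x); split; first by rewrite subKr.
  apply: bpos_limit => e e0; have [M hM] := hT e e0.
  exists (os_val (P M)); last exact: hM.
  by apply: pos_sum => k; apply: half_sqr_pos; have [] := sa k.
apply: bpos_limit => e e0; have [|M1 hM1] := hT (e / 2); first by lra.
have [|M2 hM2] := small2 (e / 2); first by lra.
pose M := maxn M1 M2; exists (os_val (N M)).
  by apply: pos_sum => k; apply: halfm_sqr_pos; have [] := sa k.
have -> : N M = P M - x + (2^-1 ^+ M)%:C *: a M.
  have := telescope M => /(congr1 (fun y => P M - y)).
  by rewrite subKr opprB addrA => ->; rewrite addrAC.
rewrite (_ : os_val _ - os_val _ = (os_val (P M) - T) + (2^-1 ^+ M)%:C *: os_val (a M)).
  apply: le_trans (opnormD _ _) _; apply: le_trans (lerD (hM1 M (leq_maxl _ _)) (opnormZ _ _)) _.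
  have h0 : 0 <= 2^-1 ^+ M :> R by rewrite exprn_ge0 ?invr_ge0.
  rewrite ger0_norm ?ler0c//=.
  have : opnorm (os_val (a M)) <= 1.
    by apply/opnorm_leP => // v; rewrite mul1r; have [_] := sa M.
  move/(ler_wpM2l h0); have := hM2 M (leq_maxr _ _); lra.
rewrite -[os_val (pT - x)]/(T - os_val x).
rewrite -[os_val (_ + _)]/(os_val (P M) - os_val x + (2^-1 ^+ M)%:C *: os_val (a M)).
by rewrite opprB addrAC addrA subrK.
Qed.

Lemma bposZ (t : R) (T : bop K) : 0 <= t -> bpos T -> bpos (t%:C *: T).
Proof.
move=> t0 [s p]; split=> [u v|u]; first by rewrite !scale_bopE !ipE s.
by rewrite scale_bopE ipE mulr_ge0// p.
Qed.

Lemma bpos_adj (T : bop K) : bpos T -> adj T = T.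
Proof. by case=> s _; exact: adj_unique. Qed.

Lemma self_adjoint_pos_decomp x : adj (os_val x) = os_val x ->
  exists p n : A, [/\ x = p - n, bpos (os_val p) & bpos (os_val n)].
Proof.
move=> hx; pose c := opnorm (os_val x) + 1.
have c0 : 0 < c by rewrite ltr_wpDl ?opnorm_ge0.
have [||p [n [e pp pn]]] := @contraction_pos_decomp ((c^-1)%:C *: x).
- by move=> u v; rewrite !scale_bopE !ipE rdot_adj hx.
- move=> v; rewrite scale_bopE rnormZr; last by rewrite invr_ge0 ltW.
  rewrite -(ler_pM2l c0) mulrA mulfV ?gt_eqF// mul1r.
  by rewrite (le_trans (opnormP _ _))// ler_wpM2r ?rnorm_ge0// lerDl.
exists (c%:C *: p), (c%:C *: n); split; try by apply: bposZ => //; exact: ltW.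
by rewrite -scalerBr -e scalerA -rmorphM/= mulfV ?gt_eqF// scale1r.
Qed.

(** The spanning of a C*-algebra by its positive elements serves three times: a completely positive
    map out of it commutes with adjoints, chi is hermitian, and the image of each [rho i] is spanned
    by positive elements of E. *)
Lemma cs_pos_decomp x : exists p1 p2 p3 p4 : A, x = (p1 - p2) + 'i%C *: (p3 - p4) /\
  [/\ bpos (os_val p1), bpos (os_val p2), bpos (os_val p3) & bpos (os_val p4)].
Proof.
have half_id : (2^-1)%:C + (2^-1)%:C = 1 :> R[i].
  by rewrite -rmorphD/= (_ : 2^-1 + 2^-1 = 1 :> R) ?rmorph1//; lra.
have ii : 'i%C * 'i%C = -1 :> R[i] by rewrite -expr2 sqr_i.
have conj_i : Num.conj 'i%C = - 'i%C :> R[i].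
  by apply/eqP; rewrite eq_complex /= oppr0 !eqxx.
pose a : A := (2^-1)%:C *: (x + os_star x).
pose b : A := (2^-1)%:C *: ('i%C *: (os_star x - x)).
have xE : x = a + 'i%C *: b.
  rewrite /a /b !scalerA [_%:C * 'i%C]mulrC mulrA ii mulN1r scaleNr -scalerN opprB.
  by rewrite -scalerDr addrACA subrr addr0 scalerDr -scalerDl half_id scale1r.
have sa : adj (os_val a) = os_val a.
  by rewrite /a [adj _]adj_bopZ adj_bopD adj_bopK conj_real [adj _ + _]addrC.
have sb : adj (os_val b) = os_val b.
  rewrite [LHS]adj_bopZ [adj _]adj_bopZ adj_bopD -scaleN1r adj_bopZ adj_bopK.
  rewrite conj_real conj_i rmorphN1 scaleN1r scaleNr -scalerN opprB.
  by [].
have [p1 [p2 [ea pp1 pp2]]] := self_adjoint_pos_decomp sa.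
have [p3 [p4 [eb pp3 pp4]]] := self_adjoint_pos_decomp sb.
by exists p1, p2, p3, p4; split; first by rewrite -ea -eb.
Qed.

End PositiveDecomposition.

Lemma os_star_decomp (R : realType) (H : hilbertSpace R) (S : operatorSystem H) (a b c d : S) :
  os_star ((a - b) + 'i%C *: (c - d)) =
  (os_star a - os_star b) - 'i%C *: (os_star c - os_star d).
Proof.
apply: val_inj.
have adjN (T : bop H) : adj (- T) = - adj T.
  by rewrite -scaleN1r adj_bopZ rmorphN1 scaleN1r.
rewrite [LHS]adj_bopD [X in X + _]adj_bopD [adj (- _)]adjN.
rewrite [X in _ + X]adj_bopZ [adj (os_val (c - d))]adj_bopD [adj (- _)]adjN.
rewrite (_ : Num.conj 'i%C = - 'i%C) ?scaleNr//.
by apply/eqP; rewrite eq_complex /= oppr0 !eqxx.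
Qed.

(** * The matrix norms of the canonical unitization *)

Section BlockMatrices.
Variables (R : realType) (H : hilbertSpace R).
Local Notation C := R[i].

Definition vjoin d (xi eta : 'I_d -> H) : 'I_(d + d) -> H :=
  fun k => match fintype.split k with inl i => xi i | inr j => eta j end.

Lemma vjoinP d (zeta : 'I_(d + d) -> H) :
  zeta = vjoin (fun i => zeta (lshift d i)) (fun i => zeta (rshift d i)).
Proof.
by apply/funext => k; rewrite /vjoin; case: splitP => i e; congr zeta; apply: val_inj.
Qed.

Lemma vdot_join d (xi eta xi' eta' : 'I_d -> H) :
  vdot (vjoin xi eta) (vjoin xi' eta') = vdot xi xi' + vdot eta eta'.
Proof.
rewrite !vdotE big_split_ord; congr (_ + _); apply: eq_bigr => i _ /=; rewrite /vjoin.
  by rewrite (unsplitK (inl i : 'I_d + 'I_d)).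
by rewrite (unsplitK (inr i : 'I_d + 'I_d)).
Qed.

Lemma mx_act_block d (X Y Z W : 'M[bop H]_d) (xi eta : 'I_d -> H) :
  mx_act (block_mx X Y Z W) (vjoin xi eta) =
  vjoin (mx_act X xi + mx_act Y eta) (mx_act Z xi + mx_act W eta).
Proof.
have joinl i : vjoin xi eta (lshift d i) = xi i.
  by rewrite /vjoin (unsplitK (inl i : 'I_d + 'I_d)).
have joinr i : vjoin xi eta (rshift d i) = eta i.
  by rewrite /vjoin (unsplitK (inr i : 'I_d + 'I_d)).
apply/funext => k; rewrite /mx_act big_split_ord {3}/vjoin.
case: splitP => i e.
  have -> : k = lshift d i by apply: val_inj.
  by congr (_ + _); apply: eq_bigr => j _; rewrite ?joinl ?joinr ?block_mxEul ?block_mxEur.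
have -> : k = rshift d i by apply: val_inj.
by congr (_ + _); apply: eq_bigr => j _; rewrite ?joinl ?joinr ?block_mxEdl ?block_mxEdr.
Qed.

Lemma block_norm d (T : 'M[bop H]_d) (t : R) : 0 <= t ->
  op_mxpos (block_mx (smx H (t%:C)%:M) T (mxadj T) (smx H (t%:C)%:M)) <-> op_mxnorm T <= t.
Proof.
move=> t0.
have formE xi eta : vdot (mx_act (block_mx (smx H (t%:C)%:M) T (mxadj T) (smx H (t%:C)%:M))
    (vjoin xi eta)) (vjoin xi eta) =
    t * vdot xi xi + 2 * vdot (mx_act T eta) xi + t * vdot eta eta.
  rewrite mx_act_block vdot_join !smx_scalar_act !ipE.
  rewrite (ipC vdot (mx_act (mxadj T) _)) -vdot_adj; lra.
split=> [/op_mxposP[_ h]|/(op_mxnorm_leP _ t0) h].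
  apply/op_mxnorm_leP => // eta.
  have [t00|tn0] := eqVneq t 0.
    rewrite t00 expr0n mul0r.
    pose a := vdot (mx_act T eta) (mx_act T eta); rewrite -/a.
    have := h (vjoin (- mx_act T eta) eta); rewrite formE t00 !ipE -/a; lra.
  have t_gt0 : 0 < t by rewrite lt_def tn0.
  (* At this vector the form equals t (t^2 ‖eta‖^2 - ‖T eta‖^2). *)
  have := h (vjoin (- mx_act T eta) (t%:C *: eta)); rewrite formE mx_actZ !ipE.
  move: (vdot _ _) (vdot eta eta) => a q h1.
  have h2 : 0 <= t * (t ^+ 2 * q - a) by lra.
  by rewrite pmulr_rge0// subr_ge0 in h2.
apply/op_mxposP; split.
  apply/symop_adj; rewrite /mxadj map_block_mx tr_block_mx.
  have := @mxadj_smx _ H d (t%:C)%:M; rewrite ctr_scalar /mxadj => ->.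
  congr block_mx; apply/matrixP => i j; rewrite !mxE ?adj_bopK//.
move=> zeta; rewrite (vjoinP zeta) formE.
set xi := fun i => _; set eta := fun i => _.
have := h eta; have := ip_CS vdot (mx_act T eta) xi.
have := ip_ge0 vdot xi; have := ip_ge0 vdot eta.
move: (vdot (mx_act T eta) (mx_act T eta)) (vdot (mx_act T eta) xi).
move: (vdot xi xi) (vdot eta eta) => p q a b q0 p0 h1 h2.
(* The cross term 2 b is bounded by 2 t ‖xi‖ ‖eta‖ <= t (‖xi‖^2 + ‖eta‖^2), here in squared form. *)
have : b ^+ 2 <= t ^+ 2 * (p * q) by nra.
move=> h3; have [b0|b0] := leP 0 b; first by rewrite !addr_ge0 ?mulr_ge0.
have : (- (2 * b)) ^+ 2 <= (t * (p + q)) ^+ 2.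
  rewrite sqrrN !exprMn (_ : 2 ^+ 2 = 4 :> R); last by lra.
  have : t ^+ 2 * (4 * (p * q)) <= t ^+ 2 * (p + q) ^+ 2.
    by rewrite ler_wpM2l ?sqr_ge0//; have := sqr_ge0 (p - q); lra.
  lra.
rewrite ler_pXn2r ?nnegrE//; last by rewrite mulr_ge0// addr_ge0.
  by lra.
by lra.
Qed.

(** With q = ‖X^* xi‖^2 = <X X^* xi, xi>, Cauchy-Schwarz gives q^2 <= c^2 q ‖xi‖^2. *)
Lemma bddop_adj d (X : 'M[bop H]_d) c :
  bddop vdot (mx_act X) c -> bddop vdot (mx_act (mxadj X)) c.
Proof.
move=> h xi; set q := vdot _ _.
have qE : q = vdot (mx_act X (mx_act (mxadj X) xi)) xi by rewrite vdot_adj.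
have := ip_CS vdot (mx_act X (mx_act (mxadj X) xi)) xi; rewrite -qE.
have := h (mx_act (mxadj X) xi); rewrite -/q; have := ip_ge0 vdot xi.
have q0 : 0 <= q := ip_ge0 _ _; move: q q0 {qE} => q q0.
move: (vdot xi xi) (vdot _ _) => s a s0 h1 h2.
have [->|qn0] := eqVneq q 0; first by rewrite mulr_ge0 ?sqr_ge0.
have q_gt0 : 0 < q by rewrite lt_def qn0.
rewrite -(ler_pM2l q_gt0) -expr2 (le_trans h2)//.
by rewrite mulrCA mulrA ler_wpM2r.
Qed.

(** The set in [sharp_norm] excludes t = 0, so for N = 0 the infimum is not attained. *)
Lemma inf_ge_nonneg (N : R) : 0 <= N -> inf [set t : R | 0 < t /\ N <= t] = N.
Proof.
move=> N0; apply/eqP; rewrite eq_le; apply/andP; split.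
  apply/ler_addgt0Pr => e e0; apply: ge_inf; first by exists 0 => t [/ltW].
  by split; lra.
apply: lb_le_inf; first by exists (N + 1); split; lra.
by move=> t [].
Qed.

End BlockMatrices.

Section SharpNorm.
Variables (R : realType) (H : hilbertSpace R) (E : operatorSystem H).
Local Notation C := R[i].

Definition sharp_block d (t : R) (Z : 'M[sharp_sort E]_d) : 'M[sharp_sort E]_(d + d) :=
  block_mx (sharp_scalar E d t) Z (sharp_mxstar Z) (sharp_scalar E d t).

Lemma sharp_norm_eq d (Z : 'M[sharp_sort E]_d) (N : R) : 0 <= N ->
  (forall t, 0 < t -> sharp_pos (sharp_block t Z) <-> N <= t) -> sharp_norm Z = N.
Proof.
move=> N0 h; rewrite /sharp_norm -[RHS]inf_ge_nonneg//; congr inf.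
by apply/seteqP; split=> t [t0 /(h _ t0)].
Qed.

Lemma sharp_block_fst d t (Z : 'M[sharp_sort E]_d) :
  vmx (map_mx fst (sharp_block t Z)) =
  block_mx 0 (vmx (map_mx fst Z)) (mxadj (vmx (map_mx fst Z))) 0.
Proof.
rewrite /vmx /sharp_block !map_block_mx.
by congr block_mx; apply/matrixP => i j; rewrite !mxE.
Qed.

Lemma sharp_block_snd d t (Z : 'M[sharp_sort E]_d) :
  map_mx snd (sharp_block t Z) =
  block_mx (t%:C)%:M (map_mx snd Z : 'M[C]_d) (ctr (map_mx snd Z)) (t%:C)%:M.
Proof.
rewrite /sharp_block !map_block_mx.
by congr block_mx; apply/matrixP => i j; rewrite !mxE.
Qed.

Lemma sharp_block_star d t (Z : 'M[sharp_sort E]_d) :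
  sharp_mxstar (sharp_block t Z) = sharp_block t Z.
Proof.
apply/sharp_mxstarP; rewrite sharp_block_fst sharp_block_snd; split.
  rewrite /mxadj map_block_mx tr_block_mx.
  by congr block_mx; apply/matrixP => i j; rewrite !mxE ?adj_bop0 ?adj_bopK.
rewrite /ctr map_block_mx tr_block_mx.
have := @ctr_scalar _ d t; rewrite /ctr => ->.
by congr block_mx; apply/matrixP => i j; rewrite !mxE ?conjCK.
Qed.

Definition sharp_inl d (X : 'M[E]_d) : 'M[sharp_sort E]_d := map_mx (fun x => (x, 0)) X.

Lemma sharp_inl_fst d (X : 'M[E]_d) : map_mx fst (sharp_inl X) = X.
Proof. by apply/matrixP => i j; rewrite !mxE. Qed.

Lemma sharp_inl_snd d (X : 'M[E]_d) : map_mx snd (sharp_inl X) = 0 :> 'M[C]_d.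
Proof. by apply/matrixP => i j; rewrite !mxE. Qed.

Lemma smx0 d : smx H (0 : 'M[C]_d) = 0.
Proof. by apply/matrixP => i j; rewrite !mxE scale0r. Qed.

Lemma psdmx0 d : psdmx (0 : 'M[C]_d).
Proof. by move=> v; rewrite mulmx0 mul0mx mxE. Qed.

Lemma sharp_inl_pos d (X : 'M[E]_d) : sharp_pos (sharp_inl X) <-> op_mxpos (vmx X).
Proof.
split=> [/sharp_pos_op_mxpos|posX].
  by rewrite sharp_inl_fst sharp_inl_snd smx0 addr0.
split; rewrite /= ?sharp_inl_fst ?sharp_inl_snd.
- apply/sharp_mxstarP; rewrite sharp_inl_fst sharp_inl_snd; split.
    by apply/symop_adj; case/op_mxposP: posX.
  by apply/matrixP => i j; rewrite !mxE conjC0.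
- exact: psdmx0.
- move=> e phi e0 [_ phi_ge0 _].
  rewrite (le_trans (_ : -1 <= 0))// cRe_ge0// phi_ge0//=.
  have [psdB _] := invsqrtmxP (@psdmx0 d) e0; have hB := psd_herm psdB.
  rewrite -/(vmx _) vmx_sandwich; set B := invsqrtmx _ in psdB hB *.
  have /op_mxposP[sX pX] := posX.
  apply/op_mxposP; split=> [x y|x].
    by rewrite !mul_mx_act (vdot_adj (smx H B)) mxadj_smx hB sX vdot_adj mxadj_smx hB.
  by rewrite !mul_mx_act vdot_adj mxadj_smx hB pX.
Qed.

(** An upper bound t is admissible because the scalar part of the block matrix is t 1: sandwiching
    the off-diagonal block, of norm at most t, by (t + e)^(-1/2) leaves norm at most 1, and
    quasistates are contractive. The converse is [sharp_pos_op_mxpos] with [block_norm]. *)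
Lemma sharp_inl_norm d (X : 'M[E]_d) : sharp_norm (sharp_inl X) = op_mxnorm (vmx X).
Proof.
apply: sharp_norm_eq; first exact: op_mxnorm_ge0.
move=> t t0; split=> [/sharp_pos_op_mxpos|hX].
  rewrite sharp_block_fst sharp_block_snd sharp_inl_fst sharp_inl_snd.
  rewrite /smx map_block_mx -!/(smx H _) add_block_mx !add0r.
  have -> : ctr (0 : 'M[C]_d) = 0 by apply/matrixP => i j; rewrite !mxE conjC0.
  by rewrite smx0 !addr0 => /(block_norm _ (ltW t0)).
split; rewrite ?sharp_block_star//.
  rewrite sharp_block_snd sharp_inl_snd.
  have -> : ctr (0 : 'M[C]_d) = 0 by apply/matrixP => i j; rewrite !mxE conjC0.
  by rewrite -scalar_mx_block -[_%:M]add0r; apply: psd_shift; [exact: psdmx0|exact: ltW].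
move=> e phi e0 [_ _ phi_le].
rewrite sharp_block_snd sharp_inl_snd.
have -> : ctr (0 : 'M[C]_d) = 0 by apply/matrixP => i j; rewrite !mxE conjC0.
rewrite -scalar_mx_block.
have psdt : psdmx ((t%:C)%:M : 'M[C]_(d + d)).
  by rewrite -[_%:M]add0r; apply: psd_shift; [exact: psdmx0|exact: ltW].
have [psdB] := invsqrtmxP psdt e0; set B := invsqrtmx _ in psdB *.
have hB := psd_herm psdB.
rewrite -raddfD/= -rmorphD/= mul_mx_scalar => BB.
set Y := map_mx fst _.
have te0 : 0 < t + e by lra.
(* From B B (t + e) = 1 and B self-adjoint; [B] enters the estimate only through this scaling of
   norms. *)
have Bn zeta : (t + e) * vdot (mx_act (smx H B) zeta) (mx_act (smx H B) zeta) = vdot zeta zeta.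
  rewrite vdot_adj mxadj_smx hB -mul_mx_act -smxM -ipZr -smx_scalar_act -mul_mx_act -smxM.
  by rewrite mul_scalar_mx BB smx_scalar_act scale1r.
have Yn zeta : vdot (mx_act (vmx Y) zeta) (mx_act (vmx Y) zeta) <= t ^+ 2 * vdot zeta zeta.
  rewrite (vjoinP zeta) sharp_block_fst sharp_inl_fst mx_act_block.
  set xi := fun i => _; set eta := fun i => _.
  have z_act (xi' : 'I_d -> H) : mx_act (0 : 'M[bop H]_d) xi' = 0.
    by apply/funext => i; rewrite /mx_act big1// => j _; rewrite mxE.
  rewrite !z_act add0r addr0 !vdot_join mulrDr addrC.
  have Xt : bddop vdot (mx_act (vmx X)) t by apply/op_mxnorm_leP => //; exact: ltW.
  by rewrite lerD// ?Xt// (bddop_adj Xt).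
have : op_mxnorm (vmx (mx_sandwich B Y)) <= 1.
  apply/op_mxnorm_leP => // zeta.
  rewrite vmx_sandwich !mul_mx_act expr1n mul1r.
  have := Bn (mx_act (vmx Y) (mx_act (smx H B) zeta)).
  have := Yn (mx_act (smx H B) zeta); have := Bn zeta; have := ip_ge0 vdot zeta.
  move: (vdot (mx_act (smx H B) _) _) (vdot (mx_act (vmx Y) _) _) (vdot _ _) (vdot _ _).
  move=> n y b z h1 h2 h3 h4.
  rewrite -(ler_pM2l (exprn_gt0 2 te0)).
  have -> : (t + e) ^+ 2 * n = (t + e) * y by rewrite -h4; ring.
  apply: le_trans (ler_wpM2l (ltW te0) h3) _.
  have -> : (t + e) * (t ^+ 2 * b) = t ^+ 2 * z by rewrite -h2; ring.
  by rewrite ler_wpM2r//; nra.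
have := normc_le_Re (phi_le (mx_sandwich B Y)).
rewrite -/(vmx _) => /andP[h _] h1; apply: le_trans h; rewrite lerN2.
exact: h1.
Qed.

End SharpNorm.

(** * The unitization respects isomorphisms *)

Section Isomorphisms.
Variable R : realType.
Local Notation C := R[i].

Lemma isometric_inv (V W : matrixSystem R) (f : {linear V -> W}) (g : {linear W -> V}) :
  cancel g f -> completely_isometric f -> completely_isometric g.
Proof.
move=> gK fi d X; rewrite -fi; congr ms_norm.
by apply/matrixP => i j; rewrite !mxE gK.
Qed.

Lemma isomorphic_trans (U V W : matrixSystem R) :
  isomorphic U V -> isomorphic V W -> isomorphic U W.
Proof.
move=> [f [g [fK gK fi fp gp]]] [f' [g' [f'K g'K f'i f'p g'p]]].
have mapc (X Y Z : lmodType C) (h : X -> Y) (k : Y -> Z) d (M : 'M[X]_d) :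
    map_mx (k \o h) M = map_mx k (map_mx h M).
  by apply/matrixP => i j; rewrite !mxE.
exists (f' \o f : {linear U -> W}), (g \o g' : {linear W -> U}); split.
- by move=> x /=; rewrite f'K fK.
- by move=> x /=; rewrite gK g'K.
- by move=> d X; rewrite mapc f'i fi.
- by move=> d X Xp; rewrite mapc; apply: f'p; exact: fp.
- by move=> d X Xp; rewrite mapc; apply: gp; exact: g'p.
Qed.

Section StarPreserving.
Variables (H K : hilbertSpace R) (E : operatorSystem H) (A : cstarAlgebra K).

Lemma cp_bpos (F G : hilbertSpace R) (S : operatorSystem F) (T : operatorSystem G)
  (f : {linear S -> T}) : completely_positive f ->
  forall p : S, bpos (os_val p) -> bpos (os_val (f p)).
Proof.
move=> fp p /bposP pp; apply/bposP.
have := fp 1%N (const_mx p); by rewrite /= !map_const_mx; apply.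
Qed.

(** Positive elements span [A], and a completely positive map sends them to positive, hence
    self-adjoint, elements. *)
Lemma cp_star (g : {linear A -> E}) : completely_positive g ->
  forall x : A, g (os_star x) = os_star (g x).
Proof.
move=> gp x; have [p1 [p2 [p3 [p4 [-> [h1 h2 h3 h4]]]]]] := cs_pos_decomp x.
have starE (p : A) : bpos (os_val p) -> os_star p = p.
  by move=> h; apply: val_inj; exact: bpos_adj.
have gstarE (p : A) : bpos (os_val p) -> os_star (g p) = g p.
  by move=> h; apply: val_inj; apply: bpos_adj; exact: cp_bpos.
rewrite os_star_decomp !starE// !(linearB, linearD, linearZ)/= os_star_decomp !gstarE//.
by rewrite -opprD scalerN.
Qed.

End StarPreserving.

Section SharpMap.
Variables (H K : hilbertSpace R) (E : operatorSystem H) (F : operatorSystem K).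
Variable f : {linear E -> F}.

Definition sharp_map (z : sharp_sort E) : sharp_sort F := (f z.1, z.2).

Fact sharp_map_linear : linear sharp_map.
Proof. by move=> a x y; rewrite /sharp_map /= linearP. Qed.

HB.instance Definition _ := GRing.isLinear.Build C (sharp_sort E) (sharp_sort F) *:%R
  sharp_map sharp_map_linear.

Hypotheses (f_star : forall x : E, f (os_star x) = os_star (f x))
  (fp : completely_positive f) (fi : completely_isometric f).

Lemma sharp_mxstar_map d (Z : 'M[sharp_sort E]_d) :
  sharp_mxstar (map_mx sharp_map Z) = map_mx sharp_map (sharp_mxstar Z).
Proof. by apply/matrixP => i j; rewrite !mxE /sharp_star /sharp_map /= f_star. Qed.

Lemma sharp_map_fst d (Z : 'M[sharp_sort E]_d) :
  map_mx fst (map_mx sharp_map Z) = map_mx f (map_mx fst Z).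
Proof. by apply/matrixP => i j; rewrite !mxE. Qed.

Lemma sharp_map_snd d (Z : 'M[sharp_sort E]_d) :
  map_mx snd (map_mx sharp_map Z) = map_mx snd Z :> 'M[C]_d.
Proof. by apply/matrixP => i j; rewrite !mxE. Qed.

(** A quasistate of F composed with [f] is a quasistate of E: complete positivity gives its
    positivity, complete isometry its norm bound. *)
Lemma sharp_map_pos d (Z : 'M[sharp_sort E]_d) :
  sharp_pos Z -> sharp_pos (map_mx sharp_map Z).
Proof.
case=> Zs psdZ h; split.
- by rewrite sharp_mxstar_map Zs.
- by rewrite sharp_map_snd.
move=> e phi e0 [phiL phi0 phile].
rewrite sharp_map_fst sharp_map_snd -map_sandwich.
apply: (h e (fun X => phi (map_mx f X)) e0); split.
- move=> a X Y; rewrite -phiL; congr phi.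
  by apply/matrixP => i j; rewrite !mxE linearP.
- by move=> X /fp/phi0.
- by move=> X; rewrite -fi.
Qed.

Lemma sharp_block_map d t (Z : 'M[sharp_sort E]_d) :
  map_mx sharp_map (sharp_block t Z) = sharp_block t (map_mx sharp_map Z).
Proof.
rewrite /sharp_block map_block_mx sharp_mxstar_map.
by congr block_mx; apply/matrixP => i j; rewrite !mxE /sharp_map linear0.
Qed.

End SharpMap.

Lemma sharp_isomorphic (H K : hilbertSpace R) (E : operatorSystem H) (A : cstarAlgebra K) :
  isomorphic E A -> isomorphic (sharp E) (sharp A).
Proof.
move=> [f [g [fK gK fi fp gp]]].
have gi := isometric_inv gK fi.
have g_star := cp_star gp.
(* [cp_star] needs a C*-algebra as domain, so it is applied to [g] and carried over to the inverse
   [f]. *)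
have f_star (x : E) : f (os_star x) = os_star (f x).
  by rewrite -{1}(fK x) -g_star gK.
have FK : cancel (sharp_map f) (sharp_map g).
  by move=> [x l]; rewrite /sharp_map /= fK.
have GK : cancel (sharp_map g) (sharp_map f).
  by move=> [x l]; rewrite /sharp_map /= gK.
have pos_iff d (Z : 'M[sharp_sort E]_d) :
    sharp_pos (map_mx (sharp_map f) Z) <-> sharp_pos Z.
  split; last exact: sharp_map_pos.
  move/(sharp_map_pos g_star gp gi).
  rewrite (_ : map_mx _ _ = Z)//; apply/matrixP => i j; rewrite !mxE; exact: FK.
exists (sharp_map f : {linear sharp E -> sharp A}),
  (sharp_map g : {linear sharp A -> sharp E}); split => //.
- move=> d Z; rewrite /= /sharp_norm; congr inf.
  apply/seteqP; split=> t [t0]; rewrite -!/(sharp_block _ _) => h; split => //.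
    by apply/pos_iff; rewrite sharp_block_map.
  by rewrite /= -/(sharp_block _ _) -sharp_block_map//; apply/pos_iff.
- by move=> d Z; exact: sharp_map_pos.
- by move=> d Z; exact: sharp_map_pos.
Qed.

End Isomorphisms.

(** * The unitization of a C*-algebra *)

(* An alias, because the product type already carries the sup norm. *)
Definition hsum (R : realType) (H : hilbertSpace R) : Type := (H * R[i]^o)%type.

Section HilbertSum.
Variables (R : realType) (H : hilbertSpace R).
Local Notation C := R[i].
Local Notation S := (hsum H).

HB.instance Definition _ := GRing.Lmodule.copy S (H * C^o)%type.

Implicit Types z w : S.

Definition hsum_form z w : C := dotp H z.1 w.1 + (z.2 : C) * Num.conj (w.2 : C).

Lemma hsum_form_re z w :
  complex.Re (hsum_form z w) = rdot H z.1 w.1 + complex.Re ((z.2 : C) * Num.conj (w.2 : C)).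
Proof. by rewrite cReD rdotE. Qed.

Fact hsum_sym z w : complex.Re (hsum_form z w) = complex.Re (hsum_form w z).
Proof.
rewrite !hsum_form_re ipC; congr (_ + _).
by case: (z.2 : C) (w.2 : C) => a b [c d] /=; ring.
Qed.

Fact hsumDl z z' w : complex.Re (hsum_form (z + z') w) =
  complex.Re (hsum_form z w) + complex.Re (hsum_form z' w).
Proof. by rewrite -cReD /hsum_form /= dotpDl mulrDl addrACA. Qed.

Fact hsumZl (t : R) z w : complex.Re (hsum_form (t%:C *: z) w) =
  t * complex.Re (hsum_form z w).
Proof. by rewrite -cRe_realM /hsum_form /= dotpZl mulrDr mulrA. Qed.

Fact hsum_ge0 z : 0 <= hsum_form z z.
Proof. by rewrite addr_ge0 ?dotp_ge0 ?mul_conjC_ge0. Qed.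

Definition hsum_inner : inner S := Inner hsum_sym hsumDl hsumZl (fun z => cRe_ge0 (hsum_ge0 z)).

Definition hsum_norm z : C := (Num.sqrt (hsum_inner z z))%:C.

Lemma hsum_formE z : hsum_form z z = (hsum_inner z z)%:C.
Proof.
have := hsum_ge0 z; rewrite /hsum_inner /=; case: (hsum_form z z) => a b.
by rewrite lecE/= => /andP[/eqP-> _].
Qed.

Fact hsum_normD z w : hsum_norm (z + w) <= hsum_norm z + hsum_norm w.
Proof.
rewrite /hsum_norm -rmorphD lecR.
rewrite -(@ler_pXn2r _ 2) ?nnegrE ?addr_ge0 ?sqrtr_ge0//.
rewrite sqrrD !sqr_sqrtr ?ip_ge0// !ipE (ipC _ w z).
have : hsum_inner z w <= Num.sqrt (hsum_inner z z) * Num.sqrt (hsum_inner w w).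
  apply: le_trans (ler_norm _) _.
  rewrite -(@ler_pXn2r _ 2) ?nnegrE ?mulr_ge0 ?sqrtr_ge0//.
  by rewrite real_normK ?num_real// exprMn !sqr_sqrtr ?ip_ge0// ip_CS.
rewrite -mulr_natl; lra.
Qed.

Fact hsum_normZ (a : C) z : hsum_norm (a *: z) = `|a| * hsum_norm z.
Proof.
have : hsum_form (a *: z) (a *: z) = `|a| ^+ 2 * hsum_form z z.
  rewrite /hsum_form /= dotpZl dotpZr sqr_normc mulrDr; congr (_ + _).
    by rewrite mulrA.
  by rewrite [a *: _]/(a * _) rmorphM mulrACA.
rewrite !hsum_formE normc_def -rmorphXn -rmorphM => /complexI e.
by rewrite /hsum_norm e -rmorphM/= sqrtrM ?sqr_ge0// sqrtr_sqr ger0_norm ?sqrtr_ge0.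
Qed.

Lemma hsum_inner_eq0 z : hsum_inner z z = 0 -> z = 0.
Proof.
rewrite /hsum_inner /= hsum_form_re => e.
have h1 := ip_ge0 (rdot H) z.1; have h2 : 0 <= complex.Re ((z.2 : C) * Num.conj (z.2 : C)).
  by rewrite cRe_ge0// mul_conjC_ge0.
have e1 : rdot H z.1 z.1 = 0 by lra.
have e2 : complex.Re ((z.2 : C) * Num.conj (z.2 : C)) = 0 by lra.
rewrite (surjective_pairing z) (rdot_eq0 e1); congr pair.
move: e2; case: (z.2 : C) => a b /= e2; apply/eqP; rewrite eq_complex/=.
have : a ^+ 2 + b ^+ 2 = 0 by lra.
by move/eqP; rewrite paddr_eq0 ?sqr_ge0// !sqrf_eq0.
Qed.

Fact hsum_norm0_eq0 z : hsum_norm z = 0 -> z = 0.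
Proof.
rewrite /hsum_norm => -[] /eqP; rewrite sqrtr_eq0 => h; apply: hsum_inner_eq0.
by apply/eqP; rewrite eq_le h ip_ge0.
Qed.

HB.instance Definition _ := Lmodule_isNormed.Build C S hsum_normD hsum_normZ hsum_norm0_eq0.

Lemma hsum_sqr_norm z : `|z| ^+ 2 = hsum_form z z.
Proof. by rewrite hsum_formE -[`|z|]/(hsum_norm z) /hsum_norm -rmorphXn sqr_sqrtr ?ip_ge0. Qed.

Lemma hsum_norm_fst z : `|z.1| <= `|z|.
Proof.
rewrite -(@ler_pXn2r _ 2) ?nnegrE// hsum_sqr_norm dotpE.
by rewrite lerDl mul_conjC_ge0.
Qed.

Lemma hsum_norm_snd z : `|z.2 : C| <= `|z|.
Proof.
rewrite -(@ler_pXn2r _ 2) ?nnegrE// hsum_sqr_norm sqr_normc.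
by rewrite lerDr dotp_ge0.
Qed.

Lemma hsum_norm_le z : `|z| <= `|z.1| + `|z.2 : C|.
Proof.
rewrite -(@ler_pXn2r _ 2) ?nnegrE ?addr_ge0// hsum_sqr_norm sqrrD dotpE sqr_normc.
by rewrite lerD2r lerDl mulrn_wge0 ?mulr_ge0.
Qed.

Lemma normc_ge_Im (x : C) : `|complex.Im x|%:C <= `|x|.
Proof.
rewrite normc_def lecR -sqrtr_sqr ler_sqrt ?addr_ge0 ?sqr_ge0//.
by rewrite lerDr sqr_ge0.
Qed.

Lemma normc_le_ReIm (x : C) : `|x| <= (`|complex.Re x| + `|complex.Im x|)%:C.
Proof.
rewrite normc_def lecR -(@ler_pXn2r _ 2) ?nnegrE ?sqrtr_ge0 ?addr_ge0//.
rewrite sqr_sqrtr ?addr_ge0 ?sqr_ge0// sqrrD !real_normK ?num_real//.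
by rewrite lerD2r lerDl mulrn_wge0 ?mulr_ge0.
Qed.

Lemma posc (e : C) : 0 < e -> exists2 r : R, 0 < r & e = r%:C.
Proof. by case: e => a b; rewrite ltcE/= => /andP[/eqP-> ?]; exists a. Qed.

(** The limit is built from the [H]-coordinate and from the real and imaginary parts of the scalar
    coordinate, each dominated by the norm of the sum. *)
Fact hsum_complete (F : set_system S) : ProperFilter F -> cauchy F -> cvg F.
Proof.
move=> FF /cauchyP Fc.
have FcR (r : R) : 0 < r -> exists z, F [set w | `|z - w| < r%:C].
  move=> r0; have [|z Fz] := Fc r%:C; first by rewrite ltcR.
  by exists z; move: Fz; rewrite -ball_normE.
have cvR (p : S -> R) : (forall z w, `|p z - p w|%:C <= `|z - w|) -> 
    exists l : R, forall r : R, 0 < r -> F [set w | `|l - p w| < r].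
  move=> hp; have : cvg (p @ F : set_system R).
    apply: cauchy_cvg; apply: cauchy_exP => r r0.
    have [z Fz] := FcR r r0; exists (p z); rewrite -ball_normE.
    by apply: (filterS (F := F) _ Fz) => w /= h; rewrite -ltcR; exact: le_lt_trans (hp _ _) h.
  move=> /cvg_ex[l /cvgrPdist_lt hl]; exists l => r r0; exact: hl.
have [h hh] : exists h : H, forall r : R, 0 < r -> F [set w | `|h - w.1| < r%:C].
  have : cvg ((fun z : S => z.1 : H) @ F : set_system H).
    apply: cauchy_cvg; apply: cauchy_exP => e /posc[r r0 ->].
    have [z Fz] := FcR r r0; exists z.1; rewrite -ball_normE.
    by apply: (filterS (F := F) _ Fz) => w /= hw; exact: le_lt_trans (hsum_norm_fst (z - w)) hw.
  move=> /cvg_ex[l /cvgrPdist_lt hl]; exists l => r r0; apply: hl.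
  by rewrite ltcR.
have [|a ha] := cvR (fun z => complex.Re (z.2 : C)).
  move=> z w; apply: le_trans (hsum_norm_snd (z - w)).
  by apply: le_trans (normc_ge_Re _); rewrite lecR /= cReD cReN.
have [|b hb] := cvR (fun z => complex.Im (z.2 : C)).
  move=> z w; apply: le_trans (hsum_norm_snd (z - w)).
  apply: le_trans (normc_ge_Im _); rewrite lecR /=.
  by case: (z.2 : C) (w.2 : C) => ? ? [].
apply: (cvgP ((h, a +i* b) : S)); apply/fcvgrPdist_lt => e /posc[r r0 ->].
have r3 : 0 < r / 3 by rewrite divr_gt0.
have FF' : Filter F by exact: filter_filter.
have Fr := filterI (filterI (ha _ r3) (hb _ r3)) (hh _ r3).
suff : F [set w : S | `|((h, a +i* b) : S) - w| < r%:C] by [].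
apply: (filterS _ (Fr _ _)) => w /= [[h1 h2] h3].
apply: le_lt_trans (hsum_norm_le _) _.
apply: le_lt_trans (lerD (ltW h3) (normc_le_ReIm _)) _.
rewrite -rmorphD ltcR /=; move: h1 h2.
case: (w.2 : C) => u v /=; lra.
Qed.

HB.instance Definition _ := Uniform_isComplete.Build S hsum_complete.

Definition hsum_cnm : completeNormedModType C := S.

Fact hsum_form_biadd_l w : zmod_morphism (hsum_form ^~ w).
Proof. by move=> x y; rewrite /hsum_form /= dotpDl mulrBl linearNl; ring. Qed.

Fact hsum_form_biadd_r z : zmod_morphism (hsum_form z).
Proof. by move=> x y; rewrite /hsum_form /= dotpDr rmorphB mulrBr linearNr; ring. Qed.

Fact hsum_form_scale_l w : scalable_for *%R (hsum_form ^~ w).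
Proof. by move=> a x; rewrite /hsum_form /= dotpZl mulrDr mulrA. Qed.

Fact hsum_form_scale_r z : scalable_for (@Num.conj C \; *%R) (hsum_form z).
Proof. by move=> a x; rewrite /hsum_form /= dotpZr rmorphM mulrDr mulrCA. Qed.

HB.instance Definition _ := isBilinear.Build C S S C *%R (@Num.conj C \; *%R) hsum_form
  hsum_form_biadd_l hsum_form_biadd_r hsum_form_scale_l hsum_form_scale_r.

Fact hsum_form_herm z w : hsum_form z w = (-1) ^+ false * Num.conj (hsum_form w z).
Proof.
by rewrite expr0 mul1r /hsum_form rmorphD rmorphM/= conjCK -dotpC [X in _ + X]mulrC.
Qed.

HB.instance Definition _ := isHermitianSesquilinear.Build C S false (@Num.conj C) hsum_form
  hsum_form_herm.

Fact hsum_form_gt0 z : z != 0 -> 0 < hsum_form z z.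
Proof. by move=> z0; rewrite -hsum_sqr_norm exprn_gt0 ?normr_gt0. Qed.

HB.instance Definition _ := isDotProduct.Build C S hsum_form hsum_form_gt0.

Definition hsum_hilbert : hilbertSpace R :=
  @HilbertSpace R hsum_cnm (hsum_form : {dot S for (@Num.conj C)}) hsum_sqr_norm.

Lemma hsum_rdotE z w : rdot hsum_hilbert z w =
  rdot H z.1 w.1 + complex.Re ((z.2 : C) * Num.conj (w.2 : C)).
Proof. by rewrite rdotE -hsum_form_re. Qed.

End HilbertSum.

Section CstarSharpPos.
Variables (R : realType) (K : hilbertSpace R) (A : cstarAlgebra K).
Local Notation C := R[i].

(** With eta = B xi, <B X B xi, xi> = <X eta, eta> >= - <M eta, eta> >= - ‖xi‖^2, so [quasistate_ge]
    applies. Positivity of the scalar part is a separate hypothesis: when [A] contains the identity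
    of [K], the operator X + M does not determine M. *)
Lemma cstar_sharp_pos d (Z : 'M[sharp_sort A]_d) : psdmx (map_mx snd Z : 'M[C]_d) ->
  op_mxpos (vmx (map_mx fst Z) + smx K (map_mx snd Z)) -> sharp_pos Z.
Proof.
set X := map_mx fst Z; set M : 'M[C]_d := map_mx snd Z => psdM pos.
have hM := psd_herm psdM.
have /op_mxposP[sXM pXM] := pos.
have sX : mxadj (vmx X) = vmx X.
  apply/symop_adj => x y; have := sXM x y; rewrite !add_mx_act !ipE.
  have /op_mxposP[sM _] := @psd_op_mxpos _ K _ _ psdM.
  by rewrite sM => /addIr.
split=> //; first by apply/sharp_mxstarP.
move=> e phi e0 qphi; rewrite -/X -/M.
have [psdB BBM] := invsqrtmxP psdM e0; have hB := psd_herm psdB.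
set B := invsqrtmx _ in psdB BBM hB *.
apply: (quasistate_ge qphi).
  apply/symop_adj => x y; rewrite vmx_sandwich !mul_mx_act.
  by rewrite (vdot_adj (smx K B)) mxadj_smx hB vdot_adj sX vdot_adj mxadj_smx hB.
move=> xi; rewrite vmx_sandwich !mul_mx_act vdot_adj mxadj_smx hB.
have BMB : B *m (M + (e%:C)%:M) *m B = 1%:M.
  by apply: mulmx1C; rewrite mulmxA.
have xiE : vdot xi xi = vdot (mx_act (smx K M) (mx_act (smx K B) xi)) (mx_act (smx K B) xi)
    + e * vdot (mx_act (smx K B) xi) (mx_act (smx K B) xi).
  have := smx_scalar_act (1 : C) xi; rewrite scale1r -BMB => {1}<-.
  rewrite !smxM !mul_mx_act vdot_adj mxadj_smx hB smxD add_mx_act smx_scalar_act.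
  by rewrite ipDl ipZl.
set eta := mx_act (smx K B) xi in xiE *.
have := pXM eta; rewrite add_mx_act ipDl; have := ip_ge0 vdot eta; rewrite xiE.
move: (vdot eta eta) (vdot _ _) (vdot _ _) => q a b q0 h.
have := mulr_ge0 (ltW e0) q0; lra.
Qed.

End CstarSharpPos.

Section UnitizationOperators.
Variables (R : realType) (K : hilbertSpace R).
Local Notation C := R[i].
Local Notation L := (hsum_hilbert K).
Implicit Types (T S : bop K) (l m : C).

Lemma rnorm_fst (z : L) : rnorm z.1 <= rnorm z.
Proof. by have := hsum_norm_fst z; rewrite [`|z.1|]rnormE [`|z|](rnormE (z : L)) lecR. Qed.

Lemma norm_Re (x : C) : `|x| = (complex.Re `|x|)%:C.
Proof. by rewrite normc_def. Qed.

Lemma rnorm_snd (z : L) : complex.Re `|z.2 : C| <= rnorm z.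
Proof. by have := hsum_norm_snd z; rewrite norm_Re [`|z|](rnormE (z : L)) lecR. Qed.

Lemma rnorm_le (z : L) : rnorm z <= rnorm z.1 + complex.Re `|z.2 : C|.
Proof.
have := hsum_norm_le z; rewrite [`|z.1|]rnormE [`|z.2 : C|]norm_Re [`|z|](rnormE (z : L)).
by rewrite -rmorphD lecR.
Qed.

Lemma rnorm_inl (v : K) : rnorm ((v, 0) : L) <= rnorm v.
Proof.
have h : complex.Re `|0 : C| = 0 by rewrite normr0.
by apply: le_trans (rnorm_le _) _; rewrite [X in _ + X]h addr0.
Qed.

Lemma rnorm_inr : rnorm ((0, 1) : L) <= 1.
Proof.
have h : complex.Re `|1 : C| = 1 by rewrite normr1.
by apply: le_trans (rnorm_le _) _; rewrite [X in _ + X]h /rnorm normr0 add0r.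
Qed.

(** On [K] alone T + l would not determine T and l if [A] contains the identity; the extra
    coordinate, scaled by l, separates them. *)
Definition uop_fun T l (z : L) : L := (T z.1 + l *: z.1, l * (z.2 : C)).

Lemma uop_fun_le T l z :
  rnorm (uop_fun T l z) <= (opnorm T + 2 * complex.Re `|l|) * rnorm z.
Proof.
have l0 : 0 <= complex.Re `|l| by rewrite cRe_ge0.
apply: le_trans (rnorm_le _) _.
have e2 : complex.Re `|l * (z.2 : C)| = complex.Re `|l| * complex.Re `|z.2 : C|.
  by rewrite normrM [`|l|]norm_Re [`|z.2 : C|]norm_Re -rmorphM.
suff : rnorm (T z.1 + l *: z.1) + complex.Re `|l * (z.2 : C)| <=
    (opnorm T + 2 * complex.Re `|l|) * rnorm z by [].
rewrite e2 mulr_natl mulr2n addrA mulrDl lerD//; last by rewrite ler_wpM2l// rnorm_snd.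
rewrite (le_trans (rnormD _ _))// mulrDl lerD//.
  by rewrite (le_trans (opnormP _ _))// ler_wpM2l ?opnorm_ge0 ?rnorm_fst.
by rewrite rnormZ ler_wpM2l// rnorm_fst.
Qed.

Fact uop_subproof T l : uop_fun T l \in @bounded_operator R L.
Proof.
have c0 : 0 <= opnorm T + 2 * complex.Re `|l|.
  by rewrite addr_ge0 ?opnorm_ge0// mulr_ge0// cRe_ge0.
apply: (@bounded_operatorP _ L _ (opnorm T + 2 * complex.Re `|l|)).
  move=> a x y; rewrite /uop_fun /=; congr pair.
    by rewrite bop_lin scalerDr !scalerA [l * a]mulrC -scalerA addrACA -scalerDr.
  by rewrite /= mulrDr [X in X + _]mulrCA.
by apply/(bddopP _ c0) => z; exact: uop_fun_le.
Qed.

Definition uop T l : bop L := Bop (uop_subproof T l).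

Lemma uopE T l (z : L) : uop T l z = (T z.1 + l *: z.1, l * (z.2 : C)) :> L.
Proof. by []. Qed.

Lemma uop_lin (a : C) S T l m : uop (a *: S + T) (a * l + m) = a *: uop S l + uop T m.
Proof.
apply: bop_ext => z; rewrite add_bopE scale_bopE !uopE.
suff : ((a *: S + T) z.1 + (a * l + m) *: z.1, (a * l + m) * (z.2 : C)) =
  (a *: (S z.1 + l *: z.1) + (T z.1 + m *: z.1), a * (l * z.2) + m * z.2) :> L by [].
congr pair; last by rewrite mulrDl -mulrA.
by rewrite add_bopE scale_bopE scalerDl scalerDr scalerA addrACA.
Qed.

Lemma uop00 : uop 0 0 = 0.
Proof.
by apply: bop_ext => z; rewrite uopE scale0r mul0r addr0.
Qed.

Lemma uop_comp S T l m : uop S l * uop T m = uop (S * T + l *: T + m *: S) (l * m).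
Proof.
apply: bop_ext => z; rewrite mul_bopE !uopE; congr pair => /=.
  by rewrite bopD bopZ scalerDr scalerA -!addrA; congr (_ + _); rewrite addrCA.
by rewrite mulrA.
Qed.

Lemma adj_uop T l : adj (uop T l) = uop (adj T) (Num.conj l).
Proof.
apply: adj_unique => z w; rewrite !hsum_rdotE !uopE /= !ipE rdot_adj -!addrA.
congr (_ + _); congr (_ + _).
  by rewrite !rdotE dotpZl dotpZr conjCK.
by case: l (z.2 : C) (w.2 : C) => a b [c e] [f g] /=; ring.
Qed.

Lemma uop1 l : uop 0 l = l *: (1 : bop L).
Proof. by apply: bop_ext => z; rewrite uopE zero_bopE add0r. Qed.

(** Together with [uop_part], this extends the coordinates of [uop T l] to bounded maps on all
    operators, so that they can be evaluated at a norm limit of such operators. *)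
Definition uop_scalar (W : bop L) : C := (W ((0, 1) : L)).2.

Definition compress_fun (W : bop L) (v : K) : K := (W ((v, 0) : L)).1.

Lemma compress_fun_le W v : rnorm (compress_fun W v) <= opnorm W * rnorm v.
Proof.
apply: le_trans (rnorm_fst _) _; apply: le_trans (opnormP _ _) _.
by rewrite ler_wpM2l ?opnorm_ge0// rnorm_inl.
Qed.

Fact compress_subproof W : compress_fun W \in @bounded_operator R K.
Proof.
apply: (@bounded_operatorP _ K _ (opnorm W)).
  move=> a x y; rewrite /compress_fun.
  have -> : ((a *: x + y, 0) : L) = a *: ((x, 0) : L) + ((y, 0) : L).
    by congr pair; rewrite /= scaler0 addr0.
  by rewrite bop_lin.
by apply/(bddopP _ (opnorm_ge0 W)) => v; exact: compress_fun_le.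
Qed.

Definition compress W : bop K := Bop (compress_subproof W).

Definition uop_part (W : bop L) : bop K := compress W - uop_scalar W *: (1 : bop K).

Lemma uopK_scalar T l : uop_scalar (uop T l) = l.
Proof. by rewrite /uop_scalar uopE /= mulr1. Qed.

Lemma uopK_part T l : uop_part (uop T l) = T.
Proof.
apply: bop_ext => v; rewrite /uop_part sub_bopE scale_bopE uopK_scalar.
by rewrite -[compress _ v]/(T v + l *: v) addrK.
Qed.

Lemma uop_norm_le T l : opnorm (uop T l) <= opnorm T + 2 * complex.Re `|l|.
Proof.
apply/opnorm_leP => [|z]; last exact: uop_fun_le.
by rewrite addr_ge0 ?opnorm_ge0// mulr_ge0// cRe_ge0.
Qed.

Lemma uop_scalar_le W : complex.Re `|uop_scalar W| <= opnorm W.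
Proof.
apply: le_trans (rnorm_snd _) _; apply: le_trans (opnormP _ _) _.
by rewrite ler_piMr ?opnorm_ge0// rnorm_inr.
Qed.

Lemma uop_part_le W : opnorm (uop_part W) <= 2 * opnorm W.
Proof.
apply/opnorm_leP => [|v]; first by rewrite mulr_ge0 ?opnorm_ge0.
rewrite /uop_part sub_bopE scale_bopE (le_trans (rnormB _ _))//.
rewrite mulr_natl mulr2n mulrDl lerD//; first exact: compress_fun_le.
by rewrite rnormZ ler_wpM2r ?rnorm_ge0// uop_scalar_le.
Qed.

Lemma uop_partB W W' : uop_part (W - W') = uop_part W - uop_part W'.
Proof.
apply: bop_ext => v; rewrite /uop_part !(sub_bopE, scale_bopE).
suff : (W ((v, 0) : L)).1 - (W' ((v, 0) : L)).1 -
  ((W ((0, 1) : L)).2 - (W' ((0, 1) : L)).2 : C) *: v =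
  (W ((v, 0) : L)).1 - (W ((0, 1) : L)).2 *: v -
  ((W' ((v, 0) : L)).1 - (W' ((0, 1) : L)).2 *: v) by [].
by rewrite scalerBl !opprD !opprK addrACA.
Qed.

Lemma uop_scalarB W W' : uop_scalar (W - W') = uop_scalar W - uop_scalar W'.
Proof. by []. Qed.

Lemma uopB S T l m : uop S l - uop T m = uop (S - T) (l - m).
Proof.
by rewrite addrC -scaleN1r -uop_lin !scaleN1r mulN1r addrC [- m + _]addrC.
Qed.

End UnitizationOperators.

Section CstarUnitization.
Variables (R : realType) (K : hilbertSpace R) (A : cstarAlgebra K).
Local Notation C := R[i].
Local Notation L := (hsum_hilbert K).

Definition unitization_pred : {pred bop L} :=
  fun W => `[< exists (x : A) (l : C), W = uop (os_val x) l >].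

Lemma unitization_predP W :
  reflect (exists (x : A) (l : C), W = uop (os_val x) l) (W \in unitization_pred).
Proof. exact: asboolP. Qed.

Fact unitization_submod : submod_closed unitization_pred.
Proof.
split; first by apply/unitization_predP; exists 0, 0; rewrite uop00.
move=> a _ _ /unitization_predP[x [l ->]] /unitization_predP[y [m ->]].
by apply/unitization_predP; exists (a *: x + y), (a * l + m); rewrite -uop_lin.
Qed.

Fact unitization_adj : {in unitization_pred, forall T, adj T \in unitization_pred}.
Proof.
move=> _ /unitization_predP[x [l ->]]; apply/unitization_predP.
by exists (os_star x), (Num.conj l); rewrite adj_uop.
Qed.

Fact unitization_closed : norm_closure [set` unitization_pred] `<=` [set` unitization_pred].
Proof.
move=> W hW.
have TA : uop_part W \in os_pred A.
  apply: os_closed => e e0; have [|U /unitization_predP[x [l ->]] hU] := hW (e / 2).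
    by lra.
  exists (os_val x); first exact: os_valP.
  have := uop_part_le (W - uop (os_val x) l); rewrite uop_partB uopK_part; lra.
apply/unitization_predP; exists (OsElt TA), (uop_scalar W).
apply/eqP; rewrite -subr_eq0; apply/eqP/bop_ext => z; rewrite zero_bopE.
apply: rnorm_eq0 => e e0; have z0 := rnorm_ge0 z.
(* The difference of an operator and its reconstruction from [uop_part] and [uop_scalar] vanishes on
   the unitization, so W may be replaced by D. Its norm is then at most ‖D‖ + 2 ‖D‖ + 2 ‖D‖, whence
   the 5. *)
have [|U /unitization_predP[x [l ->]] hU] := hW (e / (5 * (rnorm z + 1))).
  by rewrite divr_gt0//; lra.
set D := W - uop (os_val x) l in hU.
have -> : W - uop (os_val (OsElt TA)) (uop_scalar W) = D - uop (uop_part D) (uop_scalar D).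
  rewrite /D uop_partB uop_scalarB uopK_part uopK_scalar -uopB.
  by rewrite opprB addrA subrK.
apply: le_trans (opnormP _ _) _.
have : opnorm (D - uop (uop_part D) (uop_scalar D)) <= 5 * opnorm D.
  apply: le_trans (opnormB _ _) _.
  move: (uop_norm_le (uop_part D) (uop_scalar D)) (uop_part_le D) (uop_scalar_le D).
  move: (opnorm (uop _ _)) (opnorm (uop_part D)) (complex.Re _) (opnorm D).
  by clear => a b c d; lra.
move=> h; apply: le_trans (ler_wpM2r z0 h) _.
have : opnorm D * rnorm z <= e / (5 * (rnorm z + 1)) * rnorm z.
  by rewrite ler_wpM2r// ltW.
move: (opnorm D) (rnorm z) z0 e0; clear => d r r0 e0 h.
have : e / (5 * (r + 1)) * r <= e / 5.
  rewrite (_ : _ * r = e / 5 * (r / (r + 1))); last by field; lra.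
  by rewrite ler_piMr ?ler_pdivrMr; lra.
lra.
Qed.

Definition unitization_system : operatorSystem L :=
  OperatorSystem unitization_submod unitization_adj unitization_closed.

Fact unitization_comp : {in os_pred unitization_system &,
  forall S T, bop_comp S T \in os_pred unitization_system}.
Proof.
move=> _ _ /unitization_predP[x [l ->]] /unitization_predP[y [m ->]].
apply/unitization_predP; exists (cs_mul x y + l *: y + m *: x), (l * m).
by rewrite [LHS]uop_comp.
Qed.

Definition unitization : cstarAlgebra L := CstarAlgebra unitization_comp.

End CstarUnitization.

Section UnitizationIsomorphism.
Variables (R : realType) (K : hilbertSpace R) (A : cstarAlgebra K).
Local Notation C := R[i].
Local Notation L := (hsum_hilbert K).
Local Notation U := (unitization A).

Fact unitize_subproof (z : sharp_sort A) : uop (os_val z.1) z.2 \in os_pred U.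
Proof. by apply/unitization_predP; exists z.1, z.2. Qed.

Definition unitize (z : sharp_sort A) : U := OsElt (unitize_subproof z).

Fact unitize_linear : linear unitize.
Proof. by move=> a x y; apply: val_inj; exact: uop_lin. Qed.

HB.instance Definition _ := GRing.isLinear.Build C (sharp_sort A) U *:%R
  unitize unitize_linear.

Fact deunitize_subproof (W : U) : uop_part (os_val W) \in os_pred A.
Proof.
case: W => W /= /unitization_predP[x [l ->]].
by rewrite uopK_part; exact: os_valP.
Qed.

Definition deunitize (W : U) : sharp_sort A :=
  (OsElt (deunitize_subproof W), uop_scalar (os_val W)).

Lemma unitizeK : cancel unitize deunitize.
Proof.
move=> [x l]; congr pair; last exact: uopK_scalar.
by apply: val_inj; exact: uopK_part.
Qed.

Lemma deunitizeK : cancel deunitize unitize.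
Proof.
move=> W; apply: val_inj.
suff : uop (uop_part (os_val W)) (uop_scalar (os_val W)) = os_val W by [].
case: W => W /= /unitization_predP[x [l ->]].
by rewrite uopK_part uopK_scalar.
Qed.

Fact deunitize_linear : linear deunitize.
Proof. exact: (can2_linear unitizeK deunitizeK). Qed.

HB.instance Definition _ := GRing.isLinear.Build C U (sharp_sort A) *:%R
  deunitize deunitize_linear.

(** The form splits along K and C into exactly the two conditions of [cstar_sharp_pos]. *)
Lemma form_unitize d (Z : 'M[sharp_sort A]_d) (zeta : 'I_d -> L) :
  let xi i := (zeta i).1 in
  let v : 'cV[C]_d := \col_i (zeta i).2 in
  \sum_i dotp L (mx_act (vmx (map_mx unitize Z)) zeta i) (zeta i) =
  \sum_i dotp K (mx_act (vmx (map_mx fst Z) + smx K (map_mx snd Z)) xi i) (xi i) +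
  (ctr v *m (map_mx snd Z : 'M[C]_d) *m v) 0 0.
Proof.
move=> xi v.
have sum_pair (F : 'I_d -> K) (G : 'I_d -> C) :
    \sum_j ((F j, G j) : L) = ((\sum_j F j, \sum_j G j) : L).
  by elim/big_rec3: _ => // i a b c _ ->.
have actE i : mx_act (vmx (map_mx unitize Z)) zeta i =
    ((mx_act (vmx (map_mx fst Z) + smx K (map_mx snd Z)) xi i,
      \sum_j (Z i j).2 * (zeta j).2) : L).
  rewrite -sum_pair /mx_act; apply: eq_bigr => j _; rewrite !mxE.
  by rewrite uopE.
under eq_bigr do rewrite actE.
rewrite big_split; congr (_ + _).
rewrite -mulmxA mxE; apply: eq_bigr => i _; rewrite !mxE /= mulrC; congr (_ * _).
by apply: eq_bigr => j _; rewrite !mxE.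
Qed.

Lemma unitize_pos d (Z : 'M[sharp_sort A]_d) :
  sharp_pos Z <-> op_mxpos (vmx (map_mx unitize Z)).
Proof.
split=> [posZ zeta|pos].
  rewrite form_unitize addr_ge0//; first exact: (sharp_pos_op_mxpos posZ).
  by case: posZ => _ psdZ _; exact: psdZ.
(* Each condition is recovered by testing on vectors whose other coordinate is zero. *)
apply: cstar_sharp_pos => [v|xi].
  have := pos (fun i => (0, v i 0)); rewrite form_unitize /= big1 ?add0r.
    by rewrite -/(ctr v) (_ : \col_i v i 0 = v)//; apply/colP => i; rewrite mxE.
  by move=> i _; rewrite linear0r.
have := pos (fun i => (xi i, 0)); rewrite form_unitize /=.
rewrite (_ : \col_i 0 = 0 :> 'cV[C]_d) ?mulmx0 ?[X in _ + X]mxE ?addr0//.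
by apply/colP => i; rewrite !mxE.
Qed.

Lemma unitize_block d t (Z : 'M[sharp_sort A]_d) :
  vmx (map_mx unitize (sharp_block t Z)) =
  block_mx (smx L (t%:C)%:M) (vmx (map_mx unitize Z))
    (mxadj (vmx (map_mx unitize Z))) (smx L (t%:C)%:M).
Proof.
rewrite /vmx /sharp_block !map_block_mx; congr block_mx; apply/matrixP => i j;
  rewrite !mxE.
- exact: uop1.
- by rewrite [RHS]adj_uop.
- exact: uop1.
Qed.

Lemma unitize_norm d (Z : 'M[sharp_sort A]_d) :
  sharp_norm Z = op_mxnorm (vmx (map_mx unitize Z)).
Proof.
apply: sharp_norm_eq; first exact: op_mxnorm_ge0.
move=> t t0; rewrite unitize_pos unitize_block.
by apply: block_norm; exact: ltW.
Qed.

Lemma sharp_cstar_isomorphic : isomorphic (sharp A) U.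
Proof.
exists (unitize : {linear sharp A -> U}), (deunitize : {linear U -> sharp A}); split.
- exact: unitizeK.
- exact: deunitizeK.
- by move=> d Z; rewrite [RHS]unitize_norm.
- by move=> d Z /unitize_pos.
- move=> d X posX; apply/unitize_pos.
  rewrite (_ : map_mx unitize _ = X)//; apply/matrixP => i j; rewrite !mxE.
  exact: deunitizeK.
Qed.

End UnitizationIsomorphism.

(** * The kernel of the canonical character *)

Lemma Re_norm_le0 (R : realType) (w : R[i]) : complex.Re `|w| <= 0 -> w = 0.
Proof.
move=> h; apply: normr0_eq0; rewrite norm_Re; congr (_%:C).
by apply/eqP; rewrite eq_le h cRe_ge0.
Qed.

Section CharacterKernel.
Variables (R : realType) (H K : hilbertSpace R) (E : operatorSystem H) (B : cstarAlgebra K).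
Local Notation C := R[i].
Variables (f : {linear sharp E -> B}) (g : {linear B -> sharp E}).
Hypotheses (fK : cancel f g) (gK : cancel g f) (fi : completely_isometric f)
  (fp : completely_positive f) (gp : completely_positive g).

Let chi (T : B) : C := (g T).2.

Lemma chiD S T : chi (S + T) = chi S + chi T.
Proof. by rewrite /chi linearD. Qed.

Lemma chiZ (a : C) T : chi (a *: T) = a * chi T.
Proof. by rewrite /chi linearZ. Qed.

Lemma chiB S T : chi (S - T) = chi S - chi T.
Proof. by rewrite /chi linearB. Qed.

Lemma chi_pos T : bpos (os_val T) -> 0 <= chi T.
Proof.
move=> posT; have := gp (X := const_mx T : 'M[B]_1).
rewrite /= map_const_mx => /(_ (_ : op_mxpos _))[|_ psd _]; first exact/bposP.
have := psd (const_mx 1); rewrite -/(ctr _) mxE big_ord1 mxE big_ord1 !mxE.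
by rewrite conjC1 mul1r mulr1.
Qed.

Lemma chi_star T : chi (os_star T) = Num.conj (chi T).
Proof.
have starE (p : B) : bpos (os_val p) -> os_star p = p.
  by move=> h; apply: val_inj; exact: bpos_adj.
have chi_real p : bpos (os_val p) -> exists r : R, chi p = r%:C.
  move=> /chi_pos; case: (chi p) => r i; rewrite lecE/= => /andP[/eqP-> _].
  by exists r.
have [p1 [p2 [p3 [p4 [-> [h1 h2 h3 h4]]]]]] := cs_pos_decomp T.
have e1 : chi ((p1 - p2) + 'i%C *: (p3 - p4)) =
    chi p1 - chi p2 + 'i%C * (chi p3 - chi p4) by rewrite chiD chiZ !chiB.
have e2 : chi ((p1 - p2) - 'i%C *: (p3 - p4)) =
    chi p1 - chi p2 - 'i%C * (chi p3 - chi p4) by rewrite chiB chiZ !chiB.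
rewrite os_star_decomp !starE// e1 e2.
have [r1 ->] := chi_real _ h1; have [r2 ->] := chi_real _ h2.
have [r3 ->] := chi_real _ h3; have [r4 ->] := chi_real _ h4.
by apply/eqP; rewrite eq_complex /=; apply/andP; split; apply/eqP; ring.
Qed.

Lemma opnorm_sharp (z : sharp E) : opnorm (os_val (f z)) = sharp_norm (const_mx z : 'M[sharp E]_1).
Proof. by have := fi (const_mx z : 'M[sharp E]_1); rewrite /= !map_const_mx. Qed.

Lemma chi_le T : complex.Re `|chi T| <= opnorm (os_val T).
Proof.
have := opnorm_sharp (g T); rewrite gK /sharp_norm => normE.
rewrite normE; set S := [set t | _] in normE *.
(* If no t is admissible, [inf] takes its default value 0; then ‖T‖ = 0 because [f] is isometric. *)
have [[t0 St0]|nS] := pselect (S !=set0).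
  apply: lb_le_inf; first by exists t0.
  move=> t [t_gt0 [_ psd _]]; move: psd.
  rewrite -/(sharp_block _ _) sharp_block_snd map_const_mx => psd.
  (* The scalar block matrix is made to act on a Hilbert space with a visibly nonzero vector, (0,
     1), so that [block_norm] bounds |chi T| by t. *)
  pose L := hsum_hilbert K; have := @psd_op_mxpos _ L _ _ psd.
  rewrite /smx map_block_mx -!/(smx L _) -mxadj_smx => /(block_norm _ (ltW t_gt0)).
  rewrite /smx map_const_mx => /(opnorm_leP _ (ltW t_gt0))/(_ ((0, 1) : L)).
  rewrite scale_bopE rnormZ; have : 1 <= rnorm ((0, 1) : L).
    have h1 : complex.Re `|1 : C| = 1 by rewrite normr1.
    by rewrite -[X in X <= _]h1; exact: (rnorm_snd ((0, 1) : L)).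
  move=> e1; rewrite ler_pM2r//; exact: lt_le_trans ltr01 e1.
have S0 : S = set0 by rewrite -subset0 => t St; apply: nS; exists t.
rewrite S0 inf0 in normE *.
have -> : T = 0.
  apply: val_inj; apply: bop_ext => v; apply: rnorm_eq0 => e e0.
  by apply: le_trans (opnormP _ _) _; rewrite normE mul0r ltW.
have -> : chi 0 = 0 by rewrite /chi linear0.
by rewrite normr0.
Qed.

Lemma sqr_bpos (T : B) : bpos (os_val (cs_mul (os_star T) T)).
Proof.
have starE x y : rdot K (os_val (os_star T) x) y = rdot K x (os_val T y).
  by rewrite ipC [RHS]ipC [RHS]rdot_adj.
split=> [u v|u]; first by rewrite !cs_mulE starE ipC -starE [RHS]ipC.
by rewrite cs_mulE starE ip_ge0.
Qed.

Lemma bpos_sqr_le (P : B) : bpos (os_val P) ->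
  bpos (os_val ((opnorm (os_val P))%:C *: P - cs_mul P P)).
Proof.
move=> [sP pP]; set c := opnorm _; have c0 : 0 <= c := opnorm_ge0 _.
have actE w : os_val (c%:C *: P - cs_mul P P) w = c%:C *: os_val P w - os_val P (os_val P w) by [].
split=> [u v|u]; first by rewrite !actE !ipE !sP.
rewrite actE !ipE (sP (os_val P u)) subr_ge0.
apply: (symop_sqr_le (is_oper_bop _) c0 sP pP) => w.
apply: le_trans (ler_norm _) _; apply: le_trans (rdot_le _ _) _.
by rewrite rdot_rnorm expr2 mulrA ler_wpM2r ?rnorm_ge0// opnormP.
Qed.

(* Cauchy-Schwarz for chi: P^2 <= ‖P‖ P puts P into the left kernel of chi. *)
Lemma chi_mul_pos (P S : B) : bpos (os_val P) -> chi P = 0 -> chi (cs_mul S P) = 0.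
Proof.
move=> posP chiP.
have chiPP : chi (cs_mul P P) = 0.
  have := chi_pos (bpos_sqr_le posP); rewrite chiB chiZ chiP mulr0 sub0r oppr_ge0 => h1.
  have PP : bpos (os_val (cs_mul P P)).
    rewrite (_ : cs_mul P P = cs_mul (os_star P) P); first exact: sqr_bpos.
    by apply: val_inj; rewrite /= (bpos_adj posP).
  by apply/eqP; rewrite eq_le h1 chi_pos.
set z := chi (cs_mul S P).
pose q := chi (cs_mul S (os_star S)).
have q0 : 0 <= q.
  rewrite /q (_ : cs_mul S _ = cs_mul (os_star (os_star S)) (os_star S)).
    by apply: chi_pos; exact: sqr_bpos.
  by apply: val_inj; rewrite /= adj_bopK.
(* This is chi (T^* T) >= 0 for T = P + a S^*, whose term chi (P^2) vanishes. *)
have key (a : C) : 0 <= a * Num.conj z + Num.conj a * z + Num.conj a * a * q.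
  pose T := P + a *: os_star S.
  have := chi_pos (sqr_bpos T).
  rewrite (_ : cs_mul (os_star T) T = cs_mul P P + a *: os_star (cs_mul S P) +
     (Num.conj a *: cs_mul S P + (Num.conj a * a) *: cs_mul S (os_star S))).
    by rewrite !chiD !chiZ chi_star chiPP add0r addrA.
  apply: val_inj; apply: bop_ext => v.
  have starT : os_val (os_star T) = os_val P + Num.conj a *: os_val S.
    by rewrite [LHS]adj_bopD [adj (a *: _)]adj_bopZ adj_bopK (bpos_adj posP).
  have starSP : os_val (os_star (cs_mul S P)) = os_val P * adj (os_val S).
    by rewrite [LHS]adj_bopM (bpos_adj posP).
  rewrite cs_mulE starT.
  suff : (os_val P + Num.conj a *: os_val S) (os_val P v + a *: adj (os_val S) v) =
      os_val P (os_val P v) + a *: os_val (os_star (cs_mul S P)) v +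
      (Num.conj a *: os_val S (os_val P v) +
       (Num.conj a * a) *: os_val S (adj (os_val S) v)) by [].
  by rewrite starSP mul_bopE add_bopE scale_bopE !(bopD, bopZ) scalerDr scalerA.
have [r r0 zr] : exists2 r : R, 0 <= r & z * Num.conj z = r%:C.
  have := mul_conjC_ge0 z; case: (z * Num.conj z) => r i.
  by rewrite lecE/= => /andP[/eqP-> ?]; exists r.
have [t t0 qt] : exists2 t : R, 0 <= t & q = t%:C.
  by move: q0; case: (q) => t i; rewrite lecE/= => /andP[/eqP-> ?]; exists t.
(* Taking a = - s z makes both cross terms equal to - s |z|^2. *)
have key2 (s : R) : 0 <= - (2 * s) * r + s ^+ 2 * r * t.
  have conjE : Num.conj ((- s)%:C * z) = (- s)%:C * Num.conj z.
    by rewrite rmorphM; congr (_ * _); exact: conj_real.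
  have := key ((- s)%:C * z); rewrite conjE qt.
  have -> : (- s)%:C * z * Num.conj z + (- s)%:C * Num.conj z * z +
      (- s)%:C * Num.conj z * ((- s)%:C * z) * t%:C = (- (2 * s) * r + s ^+ 2 * r * t)%:C.
    move: zr; move: (Num.conj z) => zc zr.
    have -> : (- s)%:C * z * zc + (- s)%:C * zc * z + (- s)%:C * zc * ((- s)%:C * z) * t%:C =
        (- s)%:C * (z * zc) + (- s)%:C * (z * zc) + (- s)%:C * (- s)%:C * (z * zc) * t%:C.
      by ring.
    by rewrite zr -!rmorphM -!rmorphD; congr (_%:C); ring.
  by rewrite ler0c.
apply/eqP; rewrite -mul_conjC_eq0 zr; apply/eqP; congr (_%:C).
apply/eqP; rewrite eq_le r0 andbT leNgt; apply/negP => r_gt0.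
(* For small s the linear term dominates; here the value is - r (t + 2) / (t + 1)^2 < 0. *)
have := key2 (t + 1)^-1; have t1 : 0 < t + 1 by rewrite ltr_wpDl.
have -> : - (2 * (t + 1)^-1) * r + (t + 1)^-1 ^+ 2 * r * t =
    - (r * (t + 2) / (t + 1) ^+ 2) by field; rewrite gt_eqF.
by rewrite oppr_ge0 leNgt divr_gt0 ?mulr_gt0 ?exprn_gt0// ltr_wpDl.
Qed.

Let inl (x : E) : sharp E := (x, 0).

Lemma inl_linear a x y : inl (a *: x + y) = a *: inl x + inl y.
Proof. by congr pair; rewrite /= scaler0 addr0. Qed.

Lemma chi_inl x : chi (f (inl x)) = 0.
Proof. by rewrite /chi fK. Qed.

Lemma f_inl_bpos (p : E) : bpos (os_val p) -> bpos (os_val (f (inl p))).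
Proof.
move=> /bposP posp; apply/bposP.
have := fp (X := sharp_inl (const_mx p : 'M[E]_1)).
rewrite /sharp_inl !map_const_mx /= map_const_mx; apply.
have := (sharp_inl_pos (const_mx p : 'M[E]_1)).2.
by rewrite /sharp_inl /vmx !map_const_mx; apply.
Qed.

Lemma opnorm_inl x : opnorm (os_val (f (inl x))) = opnorm (os_val x).
Proof.
rewrite opnorm_sharp; have := sharp_inl_norm (const_mx x : 'M[E]_1).
by rewrite /sharp_inl /vmx !map_const_mx.
Qed.

(** The form in which the maps [rho] enter: it extends [chi_mul_pos] from positive elements to all
    of E by linearity and continuity. *)
Hypothesis pos_span_dense : forall (x : E) (e : R), 0 < e ->
  exists2 y : E, opnorm (os_val x - os_val y) < e &
  exists p1 p2 p3 p4 : E, y = (p1 - p2) + 'i%C *: (p3 - p4) /\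
  [/\ bpos (os_val p1), bpos (os_val p2), bpos (os_val p3) & bpos (os_val p4)].

Lemma cs_mulDr (S T T' : B) (a : C) : cs_mul S (a *: T + T') = a *: cs_mul S T + cs_mul S T'.
Proof. by apply: val_inj; apply: bop_ext => v; rewrite /= bopD bopZ. Qed.

Lemma chi_mul_inl S x : chi (cs_mul S (f (inl x))) = 0.
Proof.
have lin (a : C) u v : chi (cs_mul S (f (inl (a *: u + v)))) =
    a * chi (cs_mul S (f (inl u))) + chi (cs_mul S (f (inl v))).
  by rewrite inl_linear linearP cs_mulDr chiD chiZ.
have linB u v : chi (cs_mul S (f (inl (u - v)))) =
    chi (cs_mul S (f (inl u))) - chi (cs_mul S (f (inl v))).
  by rewrite addrC -scaleN1r lin mulN1r addrC.
have pos0 (p : E) : bpos (os_val p) -> chi (cs_mul S (f (inl p))) = 0.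
  by move=> posp; apply: chi_mul_pos (f_inl_bpos posp) (chi_inl p).
set w := chi _; suff : complex.Re `|w| <= 0.
  exact: Re_norm_le0.
apply/ler_addgt0Pr => e e0; rewrite add0r.
have S0 := opnorm_ge0 (os_val S).
(* The tolerance absorbs the factor ‖S‖ in ‖S f(x - y)‖ <= ‖S‖ ‖x - y‖. *)
have [|y hy [p1 [p2 [p3 [p4 [yE [h1 h2 h3 h4]]]]]]] :=
    @pos_span_dense x (e / (opnorm (os_val S) + 1)).
  by rewrite divr_gt0// ltr_wpDl.
have y0 : chi (cs_mul S (f (inl y))) = 0.
  by rewrite yE addrC lin !linB !pos0// !subrr mulr0 addr0.
have -> : w = chi (cs_mul S (f (inl (x - y)))) by rewrite linB y0 subr0.
apply: le_trans (chi_le _) _.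
have opM (U V : bop K) : opnorm (bop_comp U V) <= opnorm U * opnorm V.
  apply/opnorm_leP => [|v]; first by rewrite mulr_ge0 ?opnorm_ge0.
  apply: le_trans (opnormP U (V v)) _.
  by rewrite -mulrA ler_wpM2l ?opnorm_ge0 ?opnormP.
apply: le_trans (opM _ _) _; rewrite opnorm_inl.
apply: le_trans (ler_wpM2l S0 (ltW hy)) _.
by rewrite mulrCA ler_piMr ?(ltW e0)// ler_pdivrMr ?ltr_wpDl// mul1r lerDl.
Qed.

(** Given as a kernel rather than as the image of E, so that closure under adjoints and norm limits
    follows from [chi_star] and [chi_le]. *)
Definition kernel_pred : {pred bop K} :=
  fun W => `[< exists T : B, W = os_val T /\ chi T = 0 >].

Lemma kernel_predP W :
  reflect (exists T : B, W = os_val T /\ chi T = 0) (W \in kernel_pred).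
Proof. exact: asboolP. Qed.

Fact kernel_submod : submod_closed kernel_pred.
Proof.
split; first by apply/kernel_predP; exists 0; split=> //; rewrite /chi linear0.
move=> a _ _ /kernel_predP[S [-> S0]] /kernel_predP[T [-> T0]].
apply/kernel_predP; exists (a *: S + T); split=> //.
by rewrite chiD chiZ S0 T0 mulr0 addr0.
Qed.

Fact kernel_adj : {in kernel_pred, forall T, adj T \in kernel_pred}.
Proof.
move=> _ /kernel_predP[T [-> T0]]; apply/kernel_predP; exists (os_star T).
by split=> //; rewrite chi_star T0 conjC0.
Qed.

Fact kernel_closed : norm_closure [set` kernel_pred] `<=` [set` kernel_pred].
Proof.
move=> W hW.
have WB : W \in os_pred B.
  apply: os_closed => e /hW[_ /kernel_predP[T [-> _]] hT].
  by exists (os_val T); first exact: os_valP.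
apply/kernel_predP; exists (OsElt WB); split=> //.
set w := chi _; suff : complex.Re `|w| <= 0.
  exact: Re_norm_le0.
apply/ler_addgt0Pr => e /hW[_ /kernel_predP[T [-> T0]] hT]; rewrite add0r.
have -> : w = chi (OsElt WB - T) by rewrite chiB T0 subr0.
by apply: le_trans (chi_le _) _; exact: ltW.
Qed.

Definition kernel_system : operatorSystem K :=
  OperatorSystem kernel_submod kernel_adj kernel_closed.

Fact kernel_comp : {in os_pred kernel_system &,
  forall S T, bop_comp S T \in os_pred kernel_system}.
Proof.
move=> _ _ /kernel_predP[S [-> _]] /kernel_predP[T [-> T0]].
apply/kernel_predP; exists (cs_mul S T); split=> //.
(* An element of the kernel comes from E, so the product lies in B E, where chi vanishes. *)
rewrite -(gK T) (_ : g T = inl (g T).1); first exact: chi_mul_inl.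
by rewrite [LHS]surjective_pairing [X in (_, X)]T0.
Qed.

Definition kernel_algebra : cstarAlgebra K := CstarAlgebra kernel_comp.

Fact to_kernel_subproof x : os_val (f (inl x)) \in os_pred kernel_algebra.
Proof. by apply/kernel_predP; exists (f (inl x)); rewrite chi_inl. Qed.

Definition to_kernel (x : E) : kernel_algebra := OsElt (to_kernel_subproof x).

Fact to_kernel_linear : linear to_kernel.
Proof. by move=> a x y; apply: val_inj; rewrite /= inl_linear linearP. Qed.

HB.instance Definition _ := GRing.isLinear.Build C E kernel_algebra *:%R
  to_kernel to_kernel_linear.

Fact kernel_sub (W : kernel_algebra) : os_val W \in os_pred B.
Proof. by case: W => W /= /kernel_predP[T [-> _]]; exact: os_valP. Qed.

Definition from_kernel (W : kernel_algebra) : E := (g (OsElt (kernel_sub W))).1.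

Lemma inl_from_kernel (W : kernel_algebra) : inl (from_kernel W) = g (OsElt (kernel_sub W)).
Proof.
rewrite [RHS]surjective_pairing; congr pair.
case: W => W WK; have /kernel_predP[T [WT T0]] := WK.
by rewrite -T0 /chi; congr (g _).2; apply: val_inj.
Qed.

Lemma to_kernelK : cancel to_kernel from_kernel.
Proof.
move=> x; rewrite /from_kernel (_ : OsElt _ = f (inl x)) ?fK//.
exact: val_inj.
Qed.

Lemma from_kernelK : cancel from_kernel to_kernel.
Proof. by move=> W; apply: val_inj; rewrite /= inl_from_kernel gK. Qed.

Fact from_kernel_linear : linear from_kernel.
Proof. exact: (can2_linear to_kernelK from_kernelK). Qed.

HB.instance Definition _ := GRing.isLinear.Build C kernel_algebra E *:%R
  from_kernel from_kernel_linear.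

Lemma kernel_isomorphic : isomorphic E kernel_algebra.
Proof.
exists (to_kernel : {linear E -> kernel_algebra}),
  (from_kernel : {linear kernel_algebra -> E}); split.
- exact: to_kernelK.
- exact: from_kernelK.
- move=> d X; rewrite -[RHS]sharp_inl_norm -[RHS]fi /=; congr op_mxnorm.
  by apply/matrixP => i j; rewrite !mxE.
- move=> d X posX; have := fp (X := sharp_inl X) ((sharp_inl_pos X).2 posX).
  by rewrite /= (_ : map_mx _ _ = map_mx (@os_val _ _ _) (map_mx to_kernel X));
    last by apply/matrixP => i j; rewrite !mxE.
- move=> d W posW.
  have := gp (X := map_mx (fun w : kernel_algebra => OsElt (kernel_sub w)) W).
  rewrite (_ : map_mx g _ = sharp_inl (map_mx from_kernel W)); last first.
    by apply/matrixP => i j; rewrite !mxE -inl_from_kernel.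
  move=> h; apply/sharp_inl_pos; apply: h.
  suff : op_mxpos (vmx (map_mx (fun w : kernel_algebra => OsElt (kernel_sub w)) W : 'M[B]_d)).
    by [].
  rewrite (_ : vmx _ = vmx W)//.
  by apply/matrixP => i j; rewrite !mxE.
Qed.

End CharacterKernel.

Unset Implicit Arguments.

Theorem corollary2 (R : realType) (H : hilbertSpace R) (E : operatorSystem H)
    (I : Type) (K : I -> hilbertSpace R) (M : forall i, cstarAlgebra (K i))
    (rho : forall i, {linear M i -> E})
    (rho_pos : forall i, positive_map (rho i))
    (E_closure : [set` os_pred E] =
      norm_closure (\bigcup_i range (fun a : M i => os_val (rho i a)))) :
  isomorphic_to_cstar E <-> isomorphic_to_cstar (sharp E).
Proof.
split=> [[L [A EA]]|[L [B [f [g [fK gK fi fp gp]]]]]].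
  exists (hsum_hilbert L), (unitization A).
  exact: isomorphic_trans (sharp_isomorphic EA) (sharp_cstar_isomorphic A).
have dense (x : E) (e : R) : 0 < e ->
  exists2 y : E, opnorm (os_val x - os_val y) < e &
  exists p1 p2 p3 p4 : E, y = (p1 - p2) + 'i%C *: (p3 - p4) /\
  [/\ bpos (os_val p1), bpos (os_val p2), bpos (os_val p3) & bpos (os_val p4)].
  move=> e0; have : [set` os_pred E] (os_val x) by exact: os_valP.
  rewrite E_closure => /(_ e e0)[_ [i _ [a _ <-]] hxy].
  exists (rho i a) => //.
  (* Positivity of [rho i] on 1 by 1 matrices is enough: only the four positive summands of [a] are
     mapped. *)
  have rpos (p : M i) : bpos (os_val p) -> bpos (os_val (rho i p)).
    move=> /bposP posp; apply/bposP.
    by have := rho_pos i p; rewrite /= !map_const_mx => h; exact: h posp.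
  have [p1 [p2 [p3 [p4 [-> [h1 h2 h3 h4]]]]]] := cs_pos_decomp a.
  exists (rho i p1), (rho i p2), (rho i p3), (rho i p4); split.
    by rewrite linearD linearZ /= 2!(linearB (rho i)).
  by split; exact: rpos.
by exists L, (kernel_algebra fK gK fi fp gp dense); exact: kernel_isomorphic.
Qed.
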